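(* Let $k$ be an algebraically closed field of characteristic zero and let $X$ be a non-degenerate affine toric surface over $k$ with acting torus $T$. If the singular locus of $X$ is irreducible and one-dimensional, then the automorphism group $\operatorname{Aut}(X)$ is generated by the acting torus $T$ and the root subgroups of $X$. Moreover, $\operatorname{Aut}(X)$ is isomorphic to the semidirect product $\mathcal{U}\rtimes T$, where $\mathcal{U}$ is the subgroup of $\operatorname{Aut}(X)$ generated by all root automorphisms of $X$.
   Context: An affine toric variety $X$ (not necessarily normal) is $\operatorname{Spec}k[S]$ for an affine monoid $S=S(X)$, the monoid of characters of the acting torus $T$ that are regular on $X$; $S(X)$ generates the character lattice $M$ of $T$. Here $k[S]$ has $k$-basis $\{\chi^m:m\in S\}$ with $\chi^m\chi^{m'}=\chi^{m+m'}$. $X$ is degenerate if $k[X]^\times\ne k^\times$, and non-degenerate otherwise. With $N=\operatorname{Hom}(M,\mathbb{Z})$, set $\sigma(X)=\{u\in N_{\mathbb{Q}}:\langle m,u\rangle\ge 0\ \forall m\in S(X)\}$; $u_\rho\in N$ is the primitive generator of a ray $\rho$ of $\sigma(X)$. A Demazure root of $X$ (or of $S=S(X)$) associated with a ray $\rho$ of $\sigma(X)$ is an element $e\in M$ such that $\langle e,u_\rho\rangle=-1$ and $m+e\in S$ for every $m\in S$ with $\langle m,u_\rho\rangle>0$. It defines a $\mathbb{G}_a$-subgroup $\{\varphi_e(\alpha):\alpha\in k\}$ of $\operatorname{Aut}(X)$, acting on $k[X]=k[S]$ by $\varphi_e^*(\alpha)(\chi^m)=\sum_{i=0}^{\langle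 m,u_\rho\rangle}\binom{\langle m,u_\rho\rangle}{i}\alpha^i\chi^{m+ie}$. The elements $\varphi_e(\alpha)$ are called root automorphisms of $X$. A root subgroup of $X$ is a one-dimensional unipotent subgroup of $\operatorname{Aut}(X)$ normalized by $T$; the root subgroups are exactly the subgroups $\{\varphi_e(\alpha):\alpha\in k\}$ defined by Demazure roots $e$ of $X$. *)

(* Defs.v *)
From HB Require Import structures.
From mathcomp Require Import all_boot all_order all_algebra.
From mathcomp Require Import finmap.
From mathcomp Require Import boolp classical_sets functions.
From mathcomp Require Import monalg.

Set Implicit Arguments.
Unset Strict Implicit.
Unset Printing Implicit Defensive.

Import Order.TTheory GRing.Theory Num.Theory.
Local Open Scope classical_set_scope.
Local Open Scope ring_scope.

(* The character lattice M and the dual lattice N of an n-dimensional torus are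
   both 'rV[int]_n, and M_Q, N_Q are both 'rV[rat]_n; [pairing] is the duality
   pairing. *)
Definition pairing (R : pzRingType) (n : nat) (m u : 'rV[R]_n) : R :=
  \sum_(i < n) m 0 i * u 0 i.

(* Finitely generated submonoids of the lattice M that generate it as a group *)
Record affine_monoid (n : nat) := AffineMonoid {
  am_mem : {pred 'rV[int]_n};
  am_fg : exists (r : nat) (g : 'I_r -> 'rV[int]_n),
    (forall m, m \in am_mem <->
       exists c : 'I_r -> nat, m = \sum_(i < r) g i *+ c i) /\
    (forall m, exists c : 'I_r -> int, m = \sum_(i < r) g i *~ c i)
}.

Definition pred_of_affine_monoid (n : nat) (S : affine_monoid n) :
  {pred 'rV[int]_n} := am_mem S.
Canonical affine_monoid_predType (n : nat) :=
  PredType (@pred_of_affine_monoid n).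

Lemma am0 (n : nat) (S : affine_monoid n) : 0 \in S.
Proof.
have [r [g [memS _]]] := am_fg S; apply/memS; exists (fun=> 0%N).
by rewrite big1 // => i _; rewrite mulr0n.
Qed.

Lemma amD (n : nat) (S : affine_monoid n) (a b : 'rV[int]_n) :
  a \in S -> b \in S -> a + b \in S.
Proof.
have [r [g [memS _]]] := am_fg S.
move=> /memS[c ->] /memS[d ->]; apply/memS; exists (fun i => (c i + d i)%N).
by rewrite -big_split; apply: eq_bigr => i _; rewrite mulrnDr.
Qed.

(* The group algebra k[M].  The ring structure that monalg.v puts on {malg k[K]}
   needs a monoid K without nontrivial units, so it does not apply to a lattice. *)
Definition laurent (k : fieldType) (n : nat) := {malg k['rV[int]_n]}.

HB.instance Definition _ (k : fieldType) (n : nat) :=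
  GRing.Lmodule.copy (laurent k n) {malg k['rV[int]_n]}.

HB.lock Definition laurent_mul (k : fieldType) (n : nat) (f g : laurent k n) :
    laurent k n :=
  \sum_(a <- msupp f) \sum_(b <- msupp g) << f@_a * g@_b *g a + b >>.

HB.lock Definition chi (k : fieldType) (n : nat) (m : 'rV[int]_n) :
    laurent k n := << m >>.

Section LaurentRing.
Context (k : fieldType) (n : nat).
Local Notation M := 'rV[int]_n.
Local Notation L := (laurent k n).
Local Notation laurent_mul := (@laurent_mul k n).
Local Notation chi := (@chi k n).
Implicit Types f g h : L.

Definition laurent_one : L := << (0 : M) >>.

Lemma laurent_mul_def f g : laurent_mul f g =
  \sum_(a <- msupp f) \sum_(b <- msupp g) << f@_a * g@_b *g a + b >>.
Proof. by rewrite unlock. Qed.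

Lemma laurent_mulw (d1 d2 : {fset M}) f g :
  (msupp f `<=` d1)%fset -> (msupp g `<=` d2)%fset ->
  laurent_mul f g =
    \sum_(a <- d1) \sum_(b <- d2) (<< f@_a * g@_b *g a + b >> : L).
Proof.
move=> le1 le2; rewrite laurent_mul_def (big_fset_incl _ le1) /=.
  apply/eq_bigr=> a _; apply/big_fset_incl => // b _ /mcoeff_outdom ->.
  by rewrite mulr0 monalgU0.
move=> a _ /mcoeff_outdom fa.
by rewrite big1 => // b _; rewrite fa mul0r monalgU0.
Qed.

Lemma laurent_mulC : commutative laurent_mul.
Proof.
move=> f g; rewrite !laurent_mul_def exchange_big /=.
by apply/eq_bigr=> a _; apply/eq_bigr=> b _; rewrite mulrC addrC.
Qed.

Lemma laurent_mul0 : left_zero (0 : L) laurent_mul.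
Proof. by move=> g; rewrite laurent_mul_def msupp0 big_seq_fset0. Qed.

Lemma laurent_mulU c a g :
  laurent_mul << c *g a >> g = \sum_(b <- msupp g) << c * g@_b *g a + b >>.
Proof.
rewrite (laurent_mulw msuppU_le (fsubset_refl _)) big_seq_fset1.
by apply/eq_bigr => b _; rewrite mcoeffUU.
Qed.

Lemma laurent_mulUU c d a b :
  laurent_mul << c *g a >> << d *g b >> = << c * d *g a + b >>.
Proof.
by rewrite (laurent_mulw msuppU_le msuppU_le) !big_seq_fset1 !mcoeffUU.
Qed.

Lemma laurent_mul1 : left_id laurent_one laurent_mul.
Proof.
move=> g; rewrite laurent_mulU [RHS]monalgE.
by apply/eq_bigr=> b _; rewrite mul1r add0r.
Qed.

Lemma laurent_mulDl : left_distributive laurent_mul +%R.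
Proof.
move=> f g h.
rewrite [in RHS](laurent_mulw (fsubsetUl _ (msupp g)) (fsubset_refl _)).
rewrite [X in _ = _ + X](laurent_mulw (fsubsetUr (msupp f) _) (fsubset_refl _)).
rewrite (laurent_mulw (msuppD_le _ _) (fsubset_refl _)).
rewrite -big_split /=; apply/eq_bigr=> a _.
rewrite -big_split /=; apply/eq_bigr=> b _.
by rewrite mcoeffD mulrDl monalgUD.
Qed.

Lemma laurent_mulDr : right_distributive laurent_mul +%R.
Proof.
by move=> f g h; rewrite laurent_mulC laurent_mulDl;
  rewrite [laurent_mul g f]laurent_mulC [laurent_mul h f]laurent_mulC.
Qed.

Lemma laurent_mulr0 : right_zero (0 : L) laurent_mul.
Proof. by move=> g; rewrite laurent_mulC laurent_mul0. Qed.

Lemma laurent_ind (P : L -> Prop) :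
  P 0 -> (forall c a, P << c *g a >>) ->
  (forall f g, P f -> P g -> P (f + g)) -> forall f, P f.
Proof.
by move=> P0 PU PD f; rewrite [f]monalgE; apply: big_ind => // a _; apply: PU.
Qed.

Lemma laurent_mulA : associative laurent_mul.
Proof.
move=> f g h; elim/laurent_ind: h => [|e m|h h' IH IH'].
- by rewrite 3!laurent_mulr0.
- move: f; elim/laurent_ind: g => [|d b|g g' IH IH'] f.
  + by rewrite laurent_mul0 laurent_mulr0 laurent_mul0.
  + elim/laurent_ind: f => [|c a|f f' IH IH'].
    * by rewrite 3!laurent_mul0.
    * by rewrite (laurent_mulUU d e b m) (laurent_mulUU c d a b)
        [LHS]laurent_mulUU [RHS]laurent_mulUU mulrA addrA.
    * move: << d *g b >> << e *g m >> IH IH' => g h IH IH'.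
      by rewrite [LHS]laurent_mulDl [laurent_mul (f + f') g]laurent_mulDl
        [RHS]laurent_mulDl IH IH'.
  + move: << e *g m >> IH IH' => h IH IH'.
    by rewrite [laurent_mul (g + g') h]laurent_mulDl [LHS]laurent_mulDr
      [laurent_mul f (g + g')]laurent_mulDr [RHS]laurent_mulDl IH IH'.
- by rewrite [laurent_mul g (h + h')]laurent_mulDr [LHS]laurent_mulDr
    [RHS]laurent_mulDr IH IH'.
Qed.

Lemma laurent_one_neq0 : laurent_one != 0.
Proof. by rewrite monalgU_eq0 oner_eq0. Qed.

HB.instance Definition _ := GRing.Zmodule_isComNzRing.Build L
  laurent_mulA laurent_mulC laurent_mul1 laurent_mulDl laurent_one_neq0.

Lemma laurent_mulE f g :
  f * g = \sum_(a <- msupp f) \sum_(b <- msupp g) << f@_a * g@_b *g a + b >>.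
Proof. exact: laurent_mul_def. Qed.

Lemma laurent_scaleU (c d : k) (a : M) :
  c *: (<< d *g a >> : L) = << c * d *g a >>.
Proof.
by apply/malgP=> b; rewrite mcoeffZ [in RHS]mcoeffU mcoeffU mulrnAr.
Qed.

Lemma laurent_scalerAl (c : k) f g : c *: (f * g) = c *: f * g.
Proof.
have -> : c *: f * g = laurent_mul (c *: f) g by [].
rewrite laurent_mulE (laurent_mulw (msuppZ_le c f) (fsubset_refl _)).
rewrite scaler_sumr; apply: eq_bigr => a _; rewrite scaler_sumr.
by apply: eq_bigr => b _; rewrite laurent_scaleU mcoeffZ mulrA.
Qed.

HB.instance Definition _ :=
  GRing.Lmodule_isLalgebra.Build k L laurent_scalerAl.
HB.instance Definition _ := GRing.Lalgebra_isComAlgebra.Build k L.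

Lemma chi_def (m : M) : chi m = << m >>.
Proof. by rewrite unlock. Qed.

Lemma chiD (a b : M) : chi (a + b) = chi a * chi b.
Proof. by rewrite !chi_def [RHS]laurent_mulUU mulr1. Qed.

Lemma chi0 : chi 0 = 1. Proof. exact: chi_def. Qed.

Lemma laurent_chiE f : f = \sum_(m <- msupp f) f@_m *: chi m.
Proof.
rewrite {1}[f]monalgE; apply: eq_bigr => m _.
by rewrite chi_def laurent_scaleU mulr1.
Qed.

End LaurentRing.
Arguments chi {k n} m.


Section MonoidAlgebra.
Context (k : fieldType) (n : nat) (S : affine_monoid n).

Definition supported : {pred laurent k n} :=
  fun f => all [in S] (msupp f).

Lemma supportedP (f : laurent k n) :
  reflect (forall m, m \in msupp f -> m \in S) (f \in supported).
Proof. exact: allP. Qed.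

Lemma supported_subalg : subalg_closed supported.
Proof.
split.
- by apply/supportedP => m /(fsubsetP msuppU_le); rewrite inE => /eqP->; apply: am0.
- move=> c f g /supportedP Sf /supportedP Sg; apply/supportedP => m.
  move/(fsubsetP (msuppD_le _ _)); rewrite in_fsetU => /orP[|/Sg//].
  by move/(fsubsetP (msuppZ_le _ _))/Sf.
- move=> f g /supportedP Sf /supportedP Sg; apply/supportedP => m.
  rewrite laurent_mulE -mcoeff_neq0; apply: contraNT => Sm.
  rewrite raddf_sum big_seq big1 //= => a fa.
  rewrite raddf_sum big_seq big1 //= => b gb.
  rewrite mcoeffU; case: eqP => // abm.
  by case/negP: Sm; rewrite -abm; apply: amD; [apply: Sf | apply: Sg].
Qed.

HB.instance Definition _ :=
  GRing.isSubalgClosed.Build k (laurent k n) supported supported_subalg.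

(* The coordinate ring k[S] of the affine toric variety X with S(X) = S *)
Record monoid_algebra := MonoidAlgebra {
  ma_val :> laurent k n;
  ma_valP : ma_val \in supported
}.

HB.instance Definition _ := [isSub for ma_val].
HB.instance Definition _ := [Choice of monoid_algebra by <:].
HB.instance Definition _ := [SubChoice_isSubAlgebra of monoid_algebra by <:].
HB.instance Definition _ :=
  [SubNzRing_isSubComNzRing of monoid_algebra by <:].

Lemma chi_supported (m : 'rV[int]_n) : m \in S -> chi m \in supported.
Proof.
move=> Sm; rewrite chi_def; apply/supportedP => a /(fsubsetP msuppU_le).
by rewrite inE => /eqP->.
Qed.

Definition mono (m : 'rV[int]_n) (Sm : m \in S) : monoid_algebra :=
  MonoidAlgebra (chi_supported Sm).

End MonoidAlgebra.

Section Automorphisms.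
Context (k : fieldType) (A : comAlgType k).

(* An automorphism of the affine variety X with coordinate ring A, given by the
   corresponding automorphism of A *)
Record aut := Aut {
  pullback : {lrmorphism A -> A};
  pullback_inv : {lrmorphism A -> A};
  pullbackK : cancel pullback pullback_inv;
  pullback_invK : cancel pullback_inv pullback
}.

Lemma lrmorphism_ext (f g : {lrmorphism A -> A}) : f =1 g -> f = g.
Proof.
case: f => f [[fD] [fM] [fZ]]; case: g => g [[gD] [gM] [gZ]] /= /funext fg.
by subst g; rewrite (Prop_irrelevance fD gD) (Prop_irrelevance fM gM)
  (Prop_irrelevance fZ gZ).
Qed.

Lemma aut_ext (g h : aut) : pullback g =1 pullback h -> g = h.
Proof.
case: g h => [f f' fK f'K] [g g' gK g'K] /= /lrmorphism_ext fg; subst g.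
have f'g' : f' = g'.
  by apply: lrmorphism_ext => a; apply: (can_inj fK); rewrite f'K g'K.
by subst g'; congr Aut; apply: Prop_irrelevance.
Qed.

HB.instance Definition _ := gen_eqMixin aut.
HB.instance Definition _ := gen_choiceMixin aut.

Definition aut_one : aut :=
  @Aut idfun idfun (fun=> erefl) (fun=> erefl).

Definition aut_inv (g : aut) : aut :=
  Aut (pullback_invK g) (pullbackK g).

(* The product is composition of automorphisms of X, so the pullbacks compose in
   the opposite order. *)
Definition aut_mul (g h : aut) : aut :=
  @Aut (pullback h \o pullback g) (pullback_inv g \o pullback_inv h)
    (can_comp (pullbackK h) (pullbackK g))
    (can_comp (pullback_invK g) (pullback_invK h)).

Lemma aut_mulA : associative aut_mul.
Proof. by move=> f g h; apply: aut_ext. Qed.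
Lemma aut_mul1 : left_id aut_one aut_mul.
Proof. by move=> f; apply: aut_ext. Qed.
Lemma aut_mulr1 : right_id aut_one aut_mul.
Proof. by move=> f; apply: aut_ext. Qed.
Lemma aut_mulV : left_inverse aut_one aut_inv aut_mul.
Proof. by move=> f; apply: aut_ext => a /=; rewrite pullback_invK. Qed.
Lemma aut_mulrV : right_inverse aut_one aut_inv aut_mul.
Proof. by move=> f; apply: aut_ext => a /=; rewrite pullbackK. Qed.

HB.instance Definition _ :=
  isGroup.Build aut aut_mulA aut_mul1 aut_mulr1 aut_mulV aut_mulrV.

End Automorphisms.

Section Subgroups.
Context (G : groupType).
Implicit Types (H U T B : set G).

Definition is_subgroup H : Prop :=
  H 1%g /\ forall x y, H x -> H y -> H (x * y^-1)%g.

Definition generated B : set G := smallest is_subgroup B.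

(* G is the (internal) semidirect product of U and T, with U normal *)
Definition is_semidirect_product U T : Prop :=
  [/\ is_subgroup U /\ is_subgroup T,
      forall g u, U u -> U (g * u * g^-1)%g,
      U `&` T = [set 1%g]
    & forall g, exists u t, [/\ U u, T t & g = (u * t)%g]].

(* Multiplication in the external semidirect product for the action of T on U
   by conjugation *)
Definition sdprod_mul (p q : G * G) : G * G :=
  (p.1 * (p.2 * q.1 * p.2^-1), p.2 * q.2)%g.

Lemma semidirect_product_isom U T : is_semidirect_product U T ->
  let phi (p : G * G) := (p.1 * p.2)%g in
  [/\ forall p q, (U `*` T) p -> (U `*` T) q -> (U `*` T) (sdprod_mul p q),
      {morph phi : p q / sdprod_mul p q >-> (p * q)%g}
    & set_bij (U `*` T) setT phi].
Proof.
case=> -[[U1 Ud] [T1 Td]] Un UT0 UT.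
have V H x : is_subgroup H -> H x -> H x^-1%g.
  by move=> [H1 Hd] Hx; rewrite -[x^-1%g]mul1g; apply: Hd.
have Mu H x y : is_subgroup H -> H x -> H y -> H (x * y)%g.
  by move=> sH Hx Hy; rewrite -[y]invgK; apply: sH.2 => //; apply: V.
split.
- move=> [u t] [u' t'] [/= Uu Tt] [/= Uu' Tt']; split => /=.
    by apply: Mu => //; apply: Un.
  exact: Mu.
- by move=> [u t] [u' t'] /=; rewrite !mulgA mulgVK.
split => //.
- move=> [u t] [u' t'] /set_mem[/= Uu Tt] /set_mem[/= Uu' Tt'] e.
  have e1 : (u'^-1 * u = t' * t^-1)%g.
    by rewrite -[u](mulgK t) e !mulgA mulVg mul1g.
  have : (U `&` T) (u'^-1 * u)%g.
    split; last by rewrite e1; apply: Td.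
    by apply: Mu => //; apply: V.
  rewrite UT0 => /= e2.
  have -> : u = u' by rewrite -[u](mulVKg u') e2 mulg1.
  by rewrite e2 in e1; rewrite -[t](mul1g) {1}e1 mulgVK.
- move=> g _; have [u [t [Uu Tt ->]]] := UT g.
  by exists (u, t).
Qed.

End Subgroups.

Section AffineVariety.
Context (k : fieldType) (A : comAlgType k).

(* Closed points of Spec A, for A a finitely generated algebra over an
   algebraically closed field k *)
Definition point := {lrmorphism A -> k^o}.

Definition zero_locus (I : set A) : set point :=
  [set x | forall f, I f -> x f = 0].

Definition zclosed (Z : set point) : Prop := exists I, Z = zero_locus I.

Definition zirreducible (Z : set point) : Prop :=
  Z !=set0 /\ forall Z1 Z2, zclosed Z1 -> zclosed Z2 ->
    Z `<=` Z1 `|` Z2 -> Z `<=` Z1 \/ Z `<=` Z2.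

(* Strictly increasing chains of length d of irreducible closed subsets of the
   subspace Z *)
Definition has_chain (Z : set point) (d : nat) : Prop :=
  exists W : nat -> set point,
    (forall i, (i <= d)%N ->
       zirreducible (W i) /\ exists2 C, zclosed C & W i = Z `&` C) /\
    (forall i, (i < d)%N -> W i `<` W i.+1).

Definition zdim (Z : set point) (d : nat) : Prop :=
  has_chain Z d /\ ~ has_chain Z d.+1.

Definition max_ideal (x : point) : set A := [set f | x f = 0].

Definition max_ideal_sq (x : point) : set A :=
  [set f | exists (r : nat) (a b : 'I_r -> A),
     [/\ forall i, max_ideal x (a i), forall i, max_ideal x (b i)
       & f = \sum_(i < r) a i * b i]].

(* The cotangent space max_ideal x / max_ideal_sq x has dimension d over k. *)
Definition cotangent_dim (x : point) (d : nat) : Prop :=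
  exists b : 'I_d -> A,
    [/\ forall i, max_ideal x (b i),
        forall f, max_ideal x f -> exists c : 'I_d -> k,
          max_ideal_sq x (f - \sum_(i < d) c i *: b i)
      & forall c : 'I_d -> k, max_ideal_sq x (\sum_(i < d) c i *: b i) ->
          forall i, c i = 0].

(* Singular points of Spec A when Spec A is irreducible of dimension d: the local
   ring at x is regular iff its cotangent space has dimension d. *)
Definition singular_locus (d : nat) : set point :=
  [set x | ~ cotangent_dim x d].

Definition non_degenerate : Prop :=
  forall a b : A, a * b = 1 -> exists c : k, a = c%:A.

(* Images of faithful algebraic actions of the additive group on Spec A; the
   polynomial P is the value at f of the coaction A -> A[t]. *)
Definition is_Ga_subgroup (H : set (aut A)) : Prop :=
  exists phi : k -> aut A,
    [/\ forall a b, phi (a + b) = (phi a * phi b)%g,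
        injective phi,
        forall f, exists P : {poly A}, forall a, pullback (phi a) f = P.[a%:A]
      & H = range phi].

End AffineVariety.

Arguments singular_locus {k} A d _.

Section Cones.
Context (n : nat).
Implicit Types (C F rho : set 'rV[rat]_n) (u : 'rV[int]_n).

Definition is_face C F : Prop :=
  exists w : 'rV[rat]_n, (forall v, C v -> 0 <= pairing w v) /\
    F = [set v | C v /\ pairing w v = 0].

Definition is_ray C rho : Prop :=
  is_face C rho /\
  exists2 v, v != 0 & rho = [set c *: v | c in [set c : rat | 0 <= c]].

Definition primitive_generator rho u : Prop :=
  rho (map_mx intr u) /\
  forall (d : int) (w : 'rV[int]_n), u = d *: w -> `|d| = 1.

End Cones.

Section ToricVariety.
Context (k : fieldType) (n : nat) (S : affine_monoid n).
Local Notation M := 'rV[int]_n.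
Local Notation N := 'rV[int]_n.
Local Notation AutX := (aut (monoid_algebra k S)).

Definition sigma : set 'rV[rat]_n :=
  [set u | forall m : M, m \in S -> 0 <= pairing (map_mx intr m) u].

(* e is a Demazure root of S associated with the ray of sigma whose primitive
   generator is u. *)
Definition demazure_root (u : N) (e : M) : Prop :=
  [/\ exists2 rho, is_ray sigma rho & primitive_generator rho u,
      pairing e u = -1
    & forall m : M, m \in S -> 0 < pairing m u -> m + e \in S].

(* g = phi_e(alpha) *)
Definition is_root_aut (u : N) (e : M) (alpha : k) (g : AutX) : Prop :=
  forall (m : M) (Sm : m \in S), let l := `|pairing m u|%N in
    ma_val (pullback g (mono k Sm)) =
      \sum_(i < l.+1) ('C(l, i)%:R * alpha ^+ i) *: chi (m + e *+ i).

Definition root_automorphisms : set AutX :=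
  [set g | exists (u : N) (e : M) (alpha : k),
     demazure_root u e /\ is_root_aut u e alpha g].

(* The torus of n-tuples t of nonzero scalars, acting on k[S]: the value of the
   character m at t is \prod_i t_i ^ m_i. *)
Definition torus : set AutX :=
  [set g | exists t : 'rV[k]_n, (forall i, t 0 i != 0) /\
     forall (m : M) (Sm : m \in S),
       ma_val (pullback g (mono k Sm)) =
         (\prod_(i < n) t 0 i ^ m 0 i) *: chi m].

(* One-dimensional unipotent subgroups normalized by the torus: in characteristic
   zero a one-dimensional unipotent algebraic group is isomorphic to the additive
   group. *)
Definition is_root_subgroup (H : set AutX) : Prop :=
  is_Ga_subgroup H /\
  forall t h, torus t -> H h -> H (t * h * t^-1)%g.

End ToricVariety.

Arguments torus k {n} S _.
Arguments root_automorphisms k {n} S _.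
Arguments is_root_subgroup {k n S} H.

(* Main.v *)
(* The singular locus misses the open orbit, so it lies in one of the two boundary
   curves and contains that curve's one-dimensional orbit.  Let l and h be the
   primitive equations of the facets of the cone of S, with the singular curve
   cut out by the chi^m with h(m) > 0.  Every automorphism g preserves the ideal
   spanned by these, which is the radical of chi^n for every n <> 0 in S with
   l(n) = 0; so g(chi^n) divides a monomial, is itself a monomial, and comparing
   g with g^-1 gives g(chi^n) = c chi^n.  The other one-dimensional orbit is
   smooth, which gives a in S with l(a) = 1 such that every m in S is l(m) a up to
   {l = 0}; so g is determined by g(chi^a) and the scalars c.  Comparing leading
   terms for the two lexicographic orders (l, h) and (l, -h) yields
     g(chi^m) = t(m) chi^m (1 + f)^l(m),
   with t a character and f supported on {l = -1}.  The coefficients of the terms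
   chi^(m+e) show that the exponents e of f are Demazure roots, and t = 1 means
   that g is a product of the corresponding (commuting) root automorphisms. *)

Require Import Defs.
From HB Require Import structures.
From mathcomp Require Import all_boot all_order all_algebra.
From mathcomp Require Import finmap monalg ring zify.
From mathcomp Require Import boolp classical_sets functions.

Set Implicit Arguments.
Unset Strict Implicit.
Unset Printing Implicit Defensive.

Import Order.TTheory GRing.Theory Num.Theory.
Local Open Scope classical_set_scope.
Local Open Scope ring_scope.

(** [S] need not be saturated, so lattice points of its cone may be missing from it. Divisibility is
    reached through a fixed multiple, [frame_index], which puts every element of [S] into the
    submonoid generated by one element on each facet. Smoothness of the other orbit is tested by
    linear functionals killing the square of the maximal ideal: dimension two leaves room only for
    the direction along the facet and one irreducible class modulo the facet. The orders (l, h) and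
    (l, -h) are opposite on each level set of l, so a term leading for both has all other terms on
    strictly lower levels; as l(a) = 1 and l >= 0 on [S], this is the origin of the -1. That chi^a
    does lead is shown by following the shift d of the leading exponent through g^-1 and through
    repeated application of g. The coefficient t is multiplicative in g as well as in m, and is the
    projection of the semidirect product onto the torus. Characteristic zero keeps nonzero integral
    pairings nonzero in k, in particular the factor l(m) in the coefficient from which the root
    condition is read. *)

Section LaurentTheory.
Context (k : fieldType) (n : nat).
Local Notation M := 'rV[int]_n.
Local Notation L := (laurent k n).
Implicit Types (f g : L) (a b c m : M).

Lemma mcoeff_chi m c : (chi m : L)@_c = (m == c)%:R.
Proof. by rewrite chi_def mcoeffU. Qed.

Lemma chiMn m i : chi (m *+ i) = chi m ^+ i :> L.
Proof. by elim: i => [|i IH]; rewrite ?mulr0n ?chi0 // mulrS chiD IH exprS. Qed.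

Lemma msupp_chi m c : c \in msupp (chi m : L) -> c = m.
Proof. by rewrite -mcoeff_neq0 mcoeff_chi; case: (m =P c) => [->//|_]; rewrite eqxx. Qed.

Lemma mcoeffM f g c :
  (f * g)@_c = \sum_(a <- msupp f) f@_a * g@_(c - a).
Proof.
rewrite laurent_mulE raddf_sum /=; apply: eq_bigr => a _.
rewrite raddf_sum /=.
under eq_bigr => b _.
  rewrite mcoeffU (_ : (a + b == c) = (b == c - a)); last first.
    by rewrite [in RHS]eq_sym subr_eq [b + a]addrC eq_sym.
  over.
case: (boolP (c - a \in msupp g)) => [h|h].
  rewrite (big_fsetD1 (c - a) h) /= eqxx mulr1n big_seq big1 ?addr0 // => b.
  by rewrite !inE => /andP[/negPf-> _]; rewrite mulr0n.
rewrite (mcoeff_outdom h) mulr0 big_seq big1 // => b hb.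
by case: eqP => // e; rewrite -e hb in h.
Qed.

Lemma msuppM f g c : c \in msupp (f * g) ->
  exists a b, [/\ a \in msupp f, b \in msupp g & c = a + b].
Proof.
rewrite -mcoeff_neq0 mcoeffM => h.
case: (pselect (exists2 a, a \in msupp f & c - a \in msupp g)) => [[a fa ga]|H].
  by exists a, (c - a); rewrite addrCA subrr addr0.
case/eqP: h; rewrite big_seq big1 // => a fa.
case: (boolP (c - a \in msupp g)) => [ga|/mcoeff_outdom->]; last by rewrite mulr0.
by case: H; exists a.
Qed.

Lemma mcoeff_chiM m f c : (chi m * f)@_(m + c) = f@_c.
Proof.
rewrite chi_def mcoeffM msuppU oner_eq0 big_seq_fset1 mcoeffUU mul1r.
by rewrite addrC addKr.
Qed.

Lemma chi_neq0 m : chi m != 0 :> L.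
Proof. by rewrite chi_def monalgU_eq0 oner_eq0. Qed.

(** Linear extension of [d] from the basis of characters. The target is only a module, so that ring
    homomorphisms, images of Laurent polynomials and derivations at a point all come from this one
    construction. *)
Definition lext (V : lmodType k) (d : M -> V) f : V :=
  \sum_(m <- msupp f) f@_m *: d m.

Section Lext.
Context (V : lmodType k) (d : M -> V).

Lemma lextw (D : {fset M}) f : (msupp f `<=` D)%fset ->
  lext d f = \sum_(m <- D) f@_m *: d m.
Proof.
by move=> le; apply: big_fset_incl => // a _ /mcoeff_outdom ->; rewrite scale0r.
Qed.

Lemma lextZD (c : k) f g : lext d (c *: f + g) = c *: lext d f + lext d g.
Proof.
have h1 : (msupp (c *: f + g) `<=` msupp f `|` msupp g)%fset.
  by apply: fsubset_trans (msuppD_le _ _) _; apply: fsetSU; apply: msuppZ_le.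
rewrite (lextw h1) (lextw (fsubsetUl (msupp f) (msupp g))).
rewrite (lextw (fsubsetUr (msupp f) (msupp g))) scaler_sumr -big_split /=.
by apply: eq_bigr => m _; rewrite mcoeffD mcoeffZ scalerDl scalerA.
Qed.

HB.instance Definition _ :=
  GRing.isLinear.Build k L V *:%R (lext d) lextZD.

Lemma lext_chi m : lext d (chi m) = d m.
Proof.
by rewrite chi_def /lext msuppU oner_eq0 big_seq_fset1 mcoeffUU scale1r.
Qed.

Lemma lextM f g : lext d (f * g) =
  \sum_(a <- msupp f) \sum_(b <- msupp g) (f@_a * g@_b) *: d (a + b).
Proof.
rewrite laurent_mulE raddf_sum; apply: eq_bigr => a _.
rewrite raddf_sum; apply: eq_bigr => b _.
have -> : << f@_a * g@_b *g a + b >> = (f@_a * g@_b) *: (chi (a + b) : L).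
  by rewrite chi_def laurent_scaleU mulr1.
by rewrite /= linearZ /= lext_chi.
Qed.

End Lext.

Lemma mcoeff_lext (d : M -> L) f c :
  (lext d f)@_c = \sum_(m <- msupp f) f@_m * (d m)@_c.
Proof. by rewrite raddf_sum; apply: eq_bigr => m _; rewrite /= mcoeffZ. Qed.

End LaurentTheory.

(** * Leading exponents for a group order on the lattice *)

Section Leading.
Context (k : fieldType) (n : nat).
Local Notation M := 'rV[int]_n.
Local Notation L := (laurent k n).
Implicit Types (f g : L) (a b c m : M).

(* The positive elements of a group order on M *)
Definition positive_cone (P : pred M) : Prop :=
  [/\ forall a b, P a -> P b -> P (a + b), ~~ P 0
    & forall a, [|| a == 0, P a | P (- a)]].

Definition is_lead (P : pred M) f a : Prop :=
  f@_a != 0 /\ forall b, b \in msupp f -> b = a \/ P (a - b).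

Context (P : pred M) (P_cone : positive_cone P).

Lemma cone_anti a : P a -> P (- a) -> False.
Proof.
by case: P_cone => PD P0 _ Pa Pa'; move: (PD _ _ Pa Pa'); rewrite subrr (negPf P0).
Qed.

Lemma lead_exists f : f != 0 -> exists a, is_lead P f a.
Proof.
have [PD P0 PT] := P_cone.
move=> f0; suff: forall s : seq M, s != [::] ->
    exists2 a, a \in s & forall b, b \in s -> b = a \/ P (a - b).
  case/(_ (enum_fset (msupp f))).
    apply: contraNneq f0 => e; apply/eqP/malgP => x; rewrite mcoeff0.
    by apply: mcoeff_outdom; rewrite -[x \in _]/(x \in enum_fset (msupp f)) e.
  by move=> a fa h; exists a; split; rewrite ?mcoeff_neq0.
elim=> // a [|b s] IH _.
  by exists a; rewrite ?inE // => b; rewrite inE => /eqP; left.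
have [//|c cs hc] := IH.
case/or3P: (PT (a - c)) => [|h|h].
- rewrite subr_eq0 => /eqP ac; exists c; first by rewrite inE cs orbT.
  by move=> x; rewrite inE => /orP[/eqP->|/hc//]; left.
- exists a; first by rewrite inE eqxx.
  move=> x; rewrite inE => /orP[/eqP->|/hc]; first by left.
  move=> [->|h2]; right => //.
  by rewrite -(subrK c a) -addrA; apply: PD.
- exists c; first by rewrite inE cs orbT.
  move=> x; rewrite inE => /orP[/eqP->|/hc//]; right.
  by rewrite -opprB.
Qed.

Lemma lead_uniq f a b : is_lead P f a -> is_lead P f b -> a = b.
Proof.
move=> [fa ha] [fb hb].
case: (ha b); rewrite -?mcoeff_neq0 // => h1.
case: (hb a); rewrite -?mcoeff_neq0 // => h2.
by case: (cone_anti h1); rewrite opprB.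
Qed.

Lemma lead_chi a : is_lead P (chi a : L) a.
Proof.
split; first by rewrite mcoeff_chi eqxx oner_eq0.
by move=> b /msupp_chi; left.
Qed.

Lemma mcoeffM_lead f g a b : is_lead P f a -> is_lead P g b ->
  (f * g)@_(a + b) = f@_a * g@_b.
Proof.
move=> [fa ha] [gb hb]; rewrite mcoeffM.
rewrite (big_fsetD1 a) -?mcoeff_neq0 //= addrAC subrr add0r.
rewrite big_seq big1 ?addr0 // => x; rewrite !inE => /andP[xa fx].
case: (ha _ fx) => [e|h]; first by rewrite e eqxx in xa.
case: (boolP (a + b - x \in msupp g)) => [gx|/mcoeff_outdom->]; last first.
  by rewrite mulr0.
case: (hb _ gx) => [e|h'].
  case/negP: xa; rewrite -subr_eq0 -oppr_eq0 opprB; apply/eqP.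
  by apply: (addIr b); rewrite add0r -[RHS]e addrAC.
case: (cone_anti h); rewrite opprB.
by move: h'; rewrite opprB [a + b]addrC opprD addrCA addNKr.
Qed.

Lemma lead_mul f g a b :
  is_lead P f a -> is_lead P g b -> is_lead P (f * g) (a + b).
Proof.
have [PD P0 PT] := P_cone.
move=> lf lg; split.
  by rewrite (mcoeffM_lead lf lg) mulf_neq0 //; [case: lf | case: lg].
move=> c /msuppM[x [y [fx gy ->]]].
have -> : a + b - (x + y) = (a - x) + (b - y) by rewrite opprD addrACA.
case: (lf.2 _ fx) => [->|h1]; case: (lg.2 _ gy) => [->|h2]; rewrite ?subrr.
- by left.
- by right; rewrite add0r.
- by right; rewrite addr0.
- by right; apply: PD.
Qed.

Lemma lead_exp f a i : is_lead P f a -> is_lead P (f ^+ i) (a *+ i).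
Proof.
move=> lf; elim: i => [|i IH].
  by rewrite expr0 mulr0n -(chi0 k n); apply: lead_chi.
by rewrite exprS mulrS; apply: lead_mul.
Qed.

Lemma leadZ (c : k) f a : c != 0 -> is_lead P f a -> is_lead P (c *: f) a.
Proof.
move=> c0 [fa ha]; split; first by rewrite mcoeffZ mulf_neq0.
by move=> b /(fsubsetP (msuppZ_le _ _)); apply: ha.
Qed.

(** When the leading exponents [La m] increase strictly with [m], the top one comes from the top
    term of [f] alone, so nothing cancels it. *)
Lemma lead_lext (d : M -> L) (La : M -> M) f a :
  (forall m, m \in msupp f -> is_lead P (d m) (La m)) ->
  (forall m, m \in msupp f -> P (a - m) -> P (La a - La m)) ->
  is_lead P f a ->
  is_lead P (lext d f) (La a) /\ (lext d f)@_(La a) = f@_a * (d a)@_(La a).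
Proof.
have [PD P0 PT] := P_cone.
move=> hd hL [fa ha].
have afs : a \in msupp f by rewrite -mcoeff_neq0.
have e : (lext d f)@_(La a) = f@_a * (d a)@_(La a).
  rewrite mcoeff_lext (big_fsetD1 a) -?mcoeff_neq0 //=.
  rewrite big_seq big1 ?addr0 // => x; rewrite !inE => /andP[xa fx].
  case: (ha _ fx) => [e|/(hL _ fx) h]; first by rewrite e eqxx in xa.
  case: (boolP (La a \in msupp (d x))) => [dx|/mcoeff_outdom->]; last first.
    by rewrite mulr0.
  case: ((hd _ fx).2 _ dx) => [e|h']; first by rewrite e subrr (negPf P0) in h.
  by case: (cone_anti h); rewrite opprB.
split=> //; split; first by rewrite e mulf_neq0 //; case: (hd a afs).
move=> c; rewrite -mcoeff_neq0 mcoeff_lext => h.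
case: (pselect (exists2 x, x \in msupp f & c \in msupp (d x))) => [[x fx dx]|H].
  case: ((hd _ fx).2 _ dx) => [->|h'].
    by case: (ha _ fx) => [->|/(hL _ fx)]; [left | right].
  right; case: (ha _ fx) => [<- //|/(hL _ fx) h''].
  by rewrite -(subrK (La x) (La a)) -addrA; apply: PD.
case/eqP: h; rewrite big_seq big1 // => x fx.
case: (boolP (c \in msupp (d x))) => [dx|/mcoeff_outdom->]; last by rewrite mulr0.
by case: H; exists x.
Qed.

Lemma cone_opp : positive_cone (fun a => P (- a)).
Proof.
have [PD P0 PT] := P_cone; split.
- by move=> a b Pa Pb; rewrite opprD; apply: PD.
- by rewrite oppr0.
- by move=> a; rewrite -oppr_eq0 PT.
Qed.

End Leading.

Section Units.
Context (k : fieldType) (n : nat).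
Local Notation L := (laurent k n).

(** The highest exponents of the two factors add up to [v], and so do the lowest ones. The widths of
    the two supports are nonnegative with sum zero, hence both factors are monomials. *)
Lemma mul_eq_chi (P : pred 'rV[int]_n) (f g : L) v : positive_cone P ->
  f * g = chi v ->
  exists (c d : k) (a b : 'rV[int]_n),
    [/\ c != 0, f = c *: chi a, g = d *: chi b & a + b = v].
Proof.
move=> Pc fg.
have Pc' := cone_opp Pc.
have f0 : f != 0.
  by apply: contra_eq_neq fg => ->; rewrite mul0r eq_sym chi_neq0.
have g0 : g != 0.
  by apply: contra_eq_neq fg => ->; rewrite mulr0 eq_sym chi_neq0.
have [a la] := lead_exists Pc f0; have [b lb] := lead_exists Pc g0.
have [a' la'] := lead_exists Pc' f0; have [b' lb'] := lead_exists Pc' g0.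
have e1 : a + b = v.
  by apply: (lead_uniq Pc (lead_mul Pc la lb)); rewrite fg; apply: lead_chi.
have e2 : a' + b' = v.
  by apply: (lead_uniq Pc' (lead_mul Pc' la' lb')); rewrite fg; apply: lead_chi.
have haa : a' = a \/ P (a - a') by apply: la.2; rewrite -mcoeff_neq0; case: la'.
have hbb : b' = b \/ P (b - b') by apply: lb.2; rewrite -mcoeff_neq0; case: lb'.
have es : (a - a') + (b - b') = 0 by rewrite addrACA -opprD e1 e2 subrr.
have [PD P0 PT] := Pc.
have [ea eb] : a' = a /\ b' = b.
  case: haa es => [->|h1]; case: hbb => [->|h2] //.
  - by rewrite subrr add0r => e; rewrite e (negPf P0) in h2.
  - by rewrite subrr addr0 => e; rewrite e (negPf P0) in h1.
  - by move=> e; move: (PD _ _ h1 h2); rewrite e (negPf P0).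
have mono (h : L) x : is_lead P h x -> is_lead (fun a => P (- a)) h x ->
    h = h@_x *: chi x.
  move=> [hx h1] [_ h2]; apply/malgP => y; rewrite mcoeffZ mcoeff_chi.
  case: eqVneq => [->|xy]; first by rewrite mulr1.
  rewrite mulr0; apply: mcoeff_outdom; apply/negP => hy.
  case: (h1 _ hy) => [e|p1]; first by rewrite e eqxx in xy.
  case: (h2 _ hy) => [e|p2]; first by rewrite e eqxx in xy.
  exact: (cone_anti Pc p1 p2).
rewrite ea in la'; rewrite eb in lb'.
by exists f@_a, g@_b, a, b; split; [case: la | apply: mono | apply: mono |].
Qed.

End Units.

(* The character [chi m] as a regular function, with junk value 0 off [S] *)
HB.lock Definition reg (k : fieldType) (n : nat) (S : affine_monoid n)
    (m : 'rV[int]_n) : monoid_algebra k S := insubd 0 (chi m).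
Arguments reg {k n S} m.

(** * Regular functions and maps prescribed on monomials *)

Section MonoidAlgebraTheory.
Context (k : fieldType) (n : nat) (S : affine_monoid n).
Local Notation M := 'rV[int]_n.
Local Notation A := (monoid_algebra k S).
Implicit Types (f g : A) (a b m : M).

Lemma amMn a i : a \in S -> a *+ i \in S.
Proof.
by move=> Sa; elim: i => [|i IH]; rewrite ?mulr0n ?am0 // mulrS; apply: amD.
Qed.

Lemma am_diff m : exists a b, [/\ a \in S, b \in S & m = a - b].
Proof.
have [r [g [memS gen]]] := am_fg S; have [c ->] := gen m.
exists (\sum_i g i *+ (if c i is Posz j then j else 0%N)).
exists (\sum_i g i *+ (if c i is Negz j then j.+1 else 0%N)).
split; [by apply/memS; eexists | by apply/memS; eexists |].
rewrite -sumrB; apply: eq_bigr => i _.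
by case: (c i) => j; rewrite ?mulr0n ?subr0 ?sub0r.
Qed.

Lemma supp_in f m : m \in msupp (ma_val f) -> m \in S.
Proof. by move/supportedP: (ma_valP f); apply. Qed.

Local Notation reg := (@reg k n S).

Lemma reg_val m : m \in S -> ma_val (reg m) = chi m.
Proof. by move=> Sm; rewrite unlock insubdK //; apply: chi_supported. Qed.

Lemma reg_mono m (Sm : m \in S) : mono k Sm = reg m.
Proof. by apply: val_inj; rewrite /= reg_val. Qed.

Lemma ma_val_inj : injective (@ma_val k n S). Proof. exact: val_inj. Qed.

Lemma ma_valZD (c : k) f g : ma_val (c *: f + g) = c *: ma_val f + ma_val g.
Proof. by []. Qed.

Lemma ma_val_monoid : monoid_morphism (@ma_val k n S).
Proof. by []. Qed.

HB.instance Definition _ :=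
  GRing.isLinear.Build k A (laurent k n) *:%R (@ma_val k n S) ma_valZD.
HB.instance Definition _ :=
  GRing.isMonoidMorphism.Build A (laurent k n) (@ma_val k n S) ma_val_monoid.

Lemma ma_val_sum (I : Type) (r : seq I) (F : I -> A) :
  ma_val (\sum_(i <- r) F i) = \sum_(i <- r) ma_val (F i).
Proof. by elim/big_ind2: _ => // x1 y1 x2 y2 <- <-; exact: rmorphD. Qed.

Lemma ma_valZ (c : k) f : ma_val (c *: f) = c *: ma_val f.
Proof. by []. Qed.

Lemma ma_valM f g : ma_val (f * g) = ma_val f * ma_val g.
Proof. by []. Qed.

Lemma ma_val1 : ma_val (1 : A) = 1.
Proof. by []. Qed.

Lemma regD a b : a \in S -> b \in S -> reg (a + b) = reg a * reg b.
Proof.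
move=> Sa Sb; apply: ma_val_inj.
by rewrite ma_valM (reg_val Sa) (reg_val Sb) reg_val ?chiD // amD.
Qed.

Lemma reg0 : reg 0 = 1.
Proof. by apply: ma_val_inj; rewrite ma_val1 reg_val ?am0 // chi0. Qed.

Lemma regMn a i : a \in S -> reg (a *+ i) = reg a ^+ i.
Proof.
move=> Sa; elim: i => [|i IH]; first by rewrite mulr0n reg0.
by rewrite mulrS regD ?IH ?exprS // amMn.
Qed.

Lemma ma_expand f :
  f = \sum_(m <- msupp (ma_val f)) (ma_val f)@_m *: reg m.
Proof.
apply: ma_val_inj.
rewrite ma_val_sum [LHS]laurent_chiE.
by apply: eq_big_seq => m /supp_in Sm; rewrite ma_valZ reg_val.
Qed.

(** Universal property of [k[S]]. Supports of regular functions lie in [S], so the values of [G]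
    elsewhere are never read. *)
Lemma ma_lift (B : comAlgType k) (G : M -> B) : G 0 = 1 ->
  (forall a b, a \in S -> b \in S -> G (a + b) = G a * G b) ->
  exists F : {lrmorphism A -> B}, forall m, m \in S -> F (reg m) = G m.
Proof.
move=> G0 GD; pose F f : B := lext G (ma_val f).
have FL : linear F.
  by move=> c f g; rewrite /F ma_valZD lextZD.
have FM : monoid_morphism F.
  split; first by rewrite /F ma_val1 -(chi0 k n) lext_chi.
  move=> f g; rewrite /F ma_valM lextM /=.
  rewrite mulr_suml; apply: eq_big_seq => a /supp_in Sa.
  rewrite mulr_sumr; apply: eq_big_seq => b /supp_in Sb.
  by rewrite GD // -scalerAl -scalerAr scalerA.
pose FLi := GRing.isLinear.Build k A B *:%R F FL.
pose FMi := GRing.isMonoidMorphism.Build A B F FM.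
pose F' : {lrmorphism A -> B} := HB.pack F FLi FMi.
by exists F' => m Sm; rewrite /= /F reg_val // lext_chi.
Qed.

Lemma lrmorph_expand (B : comAlgType k) (F : {lrmorphism A -> B}) f :
  F f = \sum_(m <- msupp (ma_val f)) (ma_val f)@_m *: F (reg m).
Proof.
rewrite {1}[f]ma_expand raddf_sum; apply: eq_bigr => m _.
by rewrite /= linearZ.
Qed.

Lemma lrmorph_lext (F : {lrmorphism A -> A}) f :
  ma_val (F f) = lext (fun m => ma_val (F (reg m))) (ma_val f).
Proof.
rewrite (lrmorph_expand F f) ma_val_sum; apply: eq_bigr => m _.
exact: ma_valZ.
Qed.

Lemma lrmorph_eq (B : comAlgType k) (F G : {lrmorphism A -> B}) :
  (forall m, m \in S -> F (reg m) = G (reg m)) -> F =1 G.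
Proof.
move=> h f; rewrite (lrmorph_expand F) (lrmorph_expand G).
by apply: eq_big_seq => m /supp_in/h ->.
Qed.

Lemma aut_eq (g h : aut A) :
  (forall m, m \in S -> pullback g (reg m) = pullback h (reg m)) -> g = h.
Proof. by move=> e; apply: aut_ext; apply: lrmorph_eq. Qed.

(** [G' m] may be a combination of monomials, so its image is computed through a homomorphism
    extending [G]. The inverse conditions therefore quantify over all homomorphisms with the
    prescribed values. *)
Lemma aut_lift (G G' : M -> A) : G 0 = 1 -> G' 0 = 1 ->
  (forall a b, a \in S -> b \in S -> G (a + b) = G a * G b) ->
  (forall a b, a \in S -> b \in S -> G' (a + b) = G' a * G' b) ->
  (forall F : {lrmorphism A -> A}, (forall m, m \in S -> F (reg m) = G m) ->
    forall m, m \in S -> F (G' m) = reg m) ->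
  (forall F : {lrmorphism A -> A}, (forall m, m \in S -> F (reg m) = G' m) ->
    forall m, m \in S -> F (G m) = reg m) ->
  exists g : aut A, forall m, m \in S -> pullback g (reg m) = G m.
Proof.
move=> G0 G0' GD GD' h h'.
have [F FG] := ma_lift G0 GD; have [F' FG'] := ma_lift G0' GD'.
have FK : cancel F F'.
  apply: (lrmorph_eq (F := F' \o F) (G := idfun)) => m Sm /=.
  by rewrite FG //; apply: h'.
have FK' : cancel F' F.
  apply: (lrmorph_eq (F := F \o F') (G := idfun)) => m Sm /=.
  by rewrite FG' //; apply: h.
by exists (Aut FK FK').
Qed.

Lemma pullbackM (g h : aut A) f : pullback (g * h)%g f = pullback h (pullback g f).
Proof. by []. Qed.

Lemma pullbackV (g : aut A) f : pullback g^-1%g f = pullback_inv g f.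
Proof. by []. Qed.

Lemma pullback1 f : pullback (1%g : aut A) f = f.
Proof. by []. Qed.

(** If [m] and [- m] both lie in [S], then [chi m] is a unit, hence a scalar, and its coefficient at
    [m] forces [m = 0]. *)
Lemma non_degenerate_pointed m :
  non_degenerate A -> m \in S -> - m \in S -> m = 0.
Proof.
move=> nd Sm Sm'.
have [|c e] := nd (reg m) (reg (- m)).
  by rewrite -regD // subrr reg0.
have : (ma_val (reg m : A))@_m = (ma_val (c%:A : A))@_m by rewrite e.
rewrite reg_val // mcoeff_chi eqxx ma_valZ ma_val1 mcoeffZ.
rewrite -(chi0 k n) mcoeff_chi; case: eqP => [<-//|_].
by rewrite mulr0 => /eqP; rewrite oner_eq0.
Qed.

End MonoidAlgebraTheory.

(** * The duality pairing and the facets of a pointed plane cone *)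

Section Pairing.
Context (R : pzRingType) (n : nat).
Implicit Types a b u : 'rV[R]_n.

Lemma pairingD a b u : pairing (a + b) u = pairing a u + pairing b u.
Proof.
by rewrite /pairing -big_split; apply: eq_bigr => i _; rewrite mxE mulrDl.
Qed.

Lemma pairing0 u : pairing 0 u = 0.
Proof. by rewrite /pairing big1 // => i _; rewrite mxE mul0r. Qed.

Lemma pairingMn a i u : pairing (a *+ i) u = pairing a u *+ i.
Proof.
by elim: i => [|i IH]; rewrite ?mulr0n ?pairing0 // !mulrS pairingD IH.
Qed.

Lemma pairingN a u : pairing (- a) u = - pairing a u.
Proof. by apply: (addrI (pairing a u)); rewrite -pairingD !subrr pairing0. Qed.

Lemma pairingB a b u : pairing (a - b) u = pairing a u - pairing b u.
Proof. by rewrite pairingD pairingN. Qed.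

Lemma pairing_oppr a u : pairing a (- u) = - pairing a u.
Proof. by rewrite /pairing -sumrN; apply: eq_bigr => i _; rewrite mxE mulrN. Qed.

End Pairing.

Lemma pairing2E (R : pzRingType) (a u : 'rV[R]_2) :
  pairing a u = a 0 0 * u 0 0 + a 0 1 * u 0 1.
Proof.
rewrite /pairing 2!big_ord_recl big_ord0 addr0.
by congr (_ + a 0 _ * u 0 _); apply: val_inj.
Qed.

Lemma row2P (R : Type) (a b : 'rV[R]_2) :
  a 0 0 = b 0 0 -> a 0 1 = b 0 1 -> a = b.
Proof.
move=> h0 h1; apply/rowP => -[[|[|//]] lt].
  by rewrite (_ : Ordinal lt = 0) //; apply: val_inj.
by rewrite (_ : Ordinal lt = 1) //; apply: val_inj.
Qed.

Lemma mulrn_int (z : int) i : z *+ i = z * i%:Z.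
Proof. by rewrite -mulr_natr natz. Qed.

(* [l m := pairing m u] and [h m := pairing m u'] are the primitive equations of
   the two facets of the cone of [S], which contain [w] and [w'] respectively. *)
Record frame (S : affine_monoid 2) (w w' u u' : 'rV[int]_2) : Prop := Frame {
  frame_S : w \in S;
  frame_S' : w' \in S;
  frame_ge0 : forall m, m \in S -> 0 <= pairing m u;
  frame_ge0' : forall m, m \in S -> 0 <= pairing m u';
  frame_w0 : pairing w u = 0;
  frame_w0' : pairing w' u' = 0;
  frame_gt0 : 0 < pairing w u';
  frame_gt0' : 0 < pairing w' u;
  frame_prim : exists p, pairing p u = 1;
  frame_prim' : exists p, pairing p u' = 1
}.

Lemma frame_sym S w w' u u' : frame S w w' u u' -> frame S w' w u' u.
Proof. by case. Qed.

Section FrameExists.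
Context (S : affine_monoid 2).
Local Notation M := 'rV[int]_2.
Implicit Types a b c m w : M.

Definition det2 a b : int := a 0 0 * b 0 1 - a 0 1 * b 0 0.

(** [u] is [w] turned by a right angle and divided by the gcd of its entries; Bezout coefficients
    give the element pairing to 1 with it. *)
Lemma primitive_normal w : w != 0 -> exists u : M,
  (exists p, pairing p u = 1) /\
  exists2 d : int, 0 < d & forall m, d * pairing m u = det2 w m.
Proof.
move=> w0; set g := gcdz (w 0 0) (w 0 1).
have g0 : 0 < g.
  have gn : 0 <= g by [].
  rewrite lt_def gn andbT /g gcdz_eq0.
  apply: contraNN w0 => /andP[/eqP h0 /eqP h1].
  by apply/eqP/row2P; rewrite ?h0 ?h1 mxE.
have [x' ex] : exists x', w 0 0 = x' * g by apply/dvdzP; apply: dvdz_gcdl.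
have [y' ey] : exists x', w 0 1 = x' * g by apply/dvdzP; apply: dvdz_gcdr.
have [s [t st]] := Bezoutz (w 0 0) (w 0 1); rewrite -/g in st.
pose row2 (x y : int) : M := \row_i (if i == 0 then x else y).
have r0 x y : row2 x y 0 0 = x by rewrite mxE.
have r1 x y : row2 x y 0 1 = y by rewrite mxE.
exists (row2 (- y') x'); split.
  exists (row2 (- t) s); rewrite pairing2E !r0 !r1.
  by apply: (mulfI (lt0r_neq0 g0)); rewrite mulr1 -[RHS]st ex ey; ring.
by exists g => // m; rewrite pairing2E /det2 ex ey !r0 !r1; ring.
Qed.

Hypothesis pointed : forall m, m \in S -> - m \in S -> m = 0.

Lemma amZ m (c : int) : m \in S -> 0 <= c -> m *~ c \in S.
Proof. by case: c => // c Sm _; apply: amMn. Qed.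

Lemma pointedD a b : a \in S -> b \in S -> a + b = 0 -> a = 0.
Proof.
move=> Sa Sb /eqP; rewrite addrC addr_eq0 => /eqP e.
by apply: pointed => //; rewrite -e.
Qed.

(** Cramer's rule, as a linear relation among any three vectors of the plane. *)
Lemma det2_rel a b c : a *~ det2 b c + b *~ det2 c a + c *~ det2 a b = 0.
Proof. by apply: row2P; rewrite !mxE -?scaler_int !mxE !mulrzz /det2; ring. Qed.

Lemma mulrz_row0 a (c : int) : a *~ c = 0 -> c != 0 -> a = 0.
Proof.
move=> e c0; apply: row2P; rewrite mxE; apply: (mulIf c0).
  by move/rowP/(_ 0): e; rewrite -!scaler_int !mxE mul0r mulrC intz.
by move/rowP/(_ 1): e; rewrite -!scaler_int !mxE mul0r mulrC intz.
Qed.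

(** Transitivity of the angular order. A failure would turn Cramer's relation into one with
    nonnegative coefficients and a positive one at [b], against pointedness. The middle vector must
    be nonzero because 0 compares with everything. *)
Lemma det2_trans a b c : a \in S -> b \in S -> c \in S -> b != 0 ->
  0 <= det2 a b -> 0 <= det2 b c -> 0 <= det2 a c.
Proof.
move=> Sa Sb Sc b0 hab hbc; rewrite leNgt; apply/negP => hac.
have hca : 0 < det2 c a by move: hac; rewrite /det2; lia.
have e := det2_rel a b c; rewrite addrAC addrC in e.
move/negP: b0; apply; apply/eqP; apply: (@mulrz_row0 _ (det2 c a)); last by lia.
apply: pointedD e; first by apply: amZ => //; apply: ltW.
by apply: amD; apply: amZ.
Qed.

(** The facets are spanned by the first and last nonzero generators in the angular order. Their
    primitive normals, the second with its sign reversed, are the facet equations. *)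
Lemma frame_exists : exists w w' u u', frame S w w' u u'.
Proof.
have [r [g [memS gen]]] := am_fg S.
have Sg i : g i \in S.
  apply/memS; exists (fun j => (j == i) : nat); rewrite (bigD1 i) //= eqxx.
  by rewrite mulr1n big1 ?addr0 // => j /negPf->; rewrite mulr0n.
pose s : seq M := [seq x <- [seq g i | i : 'I_r] | x != 0].
have sS x : x \in s -> x \in S /\ x != 0.
  by rewrite mem_filter => /andP[x0 /mapP[i _ e]]; rewrite {1}e.
have ext (t : seq M) : {subset t <= s} -> t != [::] -> exists w w', [/\ w \in s, w' \in s,
    forall x, x \in t -> 0 <= det2 w x & forall x, x \in t -> 0 <= det2 x w'].
  elim: t => // a t IH sub _; have sa : a \in s by apply: sub; rewrite inE eqxx.
  have [->|t0] := eqVneq t [::].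
    exists a, a; split => // x; rewrite inE => /eqP->; rewrite /det2; lia.
  have [|w [w' [sw sw' hw hw']]] := IH _ t0.
    by move=> x tx; apply: sub; rewrite inE tx orbT.
  have tr x y z : x \in s -> y \in s -> z \in s -> 0 <= det2 x y ->
      0 <= det2 y z -> 0 <= det2 x z.
    move=> /sS[Sx _] /sS[Sy y0] /sS[Sz _]; exact: det2_trans.
  have ts x : x \in t -> x \in s by move=> tx; apply: sub; rewrite inE tx orbT.
  have refl x : 0 <= det2 x x by rewrite /det2; lia.
  have tot x y : 0 <= det2 x y \/ 0 <= det2 y x by rewrite /det2; lia.
  have [v [sv hv hva]] : exists v, [/\ v \in s,
      forall x, x \in t -> 0 <= det2 v x & 0 <= det2 v a].
    case: (tot w a) => h; first by exists w.
    by exists a; split=> // x tx; apply: (tr a w) => //; [apply: ts | apply: hw].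
  have [v' [sv' hv' hva']] : exists v, [/\ v \in s,
      forall x, x \in t -> 0 <= det2 x v & 0 <= det2 a v].
    case: (tot a w') => h; first by exists w'.
    by exists a; split=> // x tx; apply: (tr x w') => //; [apply: ts | apply: hw'].
  by exists v, v'; split=> // x; rewrite inE => /orP[/eqP->//|]; auto.
have det2Dr a b c : det2 a (b + c) = det2 a b + det2 a c.
  by rewrite /det2 !mxE; ring.
have det2Nr a b : det2 a (- b) = - det2 a b by rewrite /det2 !mxE; ring.
have det2r0 a : det2 a 0 = 0 by rewrite /det2 !mxE; ring.
have det2C a b : det2 a b = - det2 b a by rewrite /det2; ring.
have det2Mr a b i : det2 a (b *+ i) = det2 a b *+ i.
  by elim: i => [|i IH]; rewrite ?mulr0n ?det2r0 // !mulrS det2Dr IH.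
have spanS w : (forall x, x \in s -> 0 <= det2 w x) ->
    forall m, m \in S -> 0 <= det2 w m.
  move=> h m /memS[c ->]; apply: (big_ind (fun x => 0 <= det2 w x)) => [|x y hx hy|i _].
  - by rewrite det2r0.
  - by rewrite det2Dr addr_ge0.
  rewrite det2Mr mulrn_wge0 //.
  case: (eqVneq (g i) 0) => [->|g0]; first by rewrite det2r0.
  by apply: h; rewrite mem_filter g0 /=; apply/mapP; exists i; rewrite ?mem_enum.
have det2_nondeg w : (forall m, m \in S -> det2 w m = 0) -> w = 0.
  move=> h; have h' m : det2 w m = 0.
    have [a [b [Sa Sb ->]]] := am_diff S m.
    by rewrite det2Dr det2Nr !h // subrr.
  have := h' (\row_i (i == 0)%:R); have := h' (\row_i (i == 1)%:R).
  rewrite /det2 !mxE /= => h1 h0; apply: row2P; rewrite mxE; lia.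
have det2Nl a b : det2 (- a) b = - det2 a b by rewrite /det2 !mxE; ring.
have s0 : s != [::].
  apply/negP => /eqP se.
  have e (v : M) : v = 0.
    apply: det2_nondeg => m Sm; apply: le_anti; apply/andP; split.
      by rewrite -oppr_ge0 -det2Nl; apply: spanS Sm => x; rewrite se.
    by apply: spanS Sm => x; rewrite se.
  by move/rowP/(_ 0): (e (const_mx 1)); rewrite !mxE.
have [w [w' [sw sw' hw hw']]] := ext s (fun x => id) s0.
have [Sw w0] := sS _ sw; have [Sw' w0'] := sS _ sw'.
have hwS := spanS _ hw.
have hwS' m : m \in S -> 0 <= det2 m w'.
  move=> Sm; rewrite det2C -det2Nl; apply: spanS Sm => x sx.
  by rewrite det2Nl -det2C hw'.
(* If the extreme generators were parallel, Cramer's relation with nonnegative coefficients and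
   pointedness would give [det2 w m = 0] on all of [S], hence on the lattice, and then [w = 0]. *)
have dpos : 0 < det2 w w'.
  rewrite lt_def hwS // andbT; apply/eqP => d0.
  move/negP: w0; apply; apply/eqP; apply: det2_nondeg => m Sm.
  have e := det2_rel w w' m; rewrite d0 mulr0z addr0 addrC in e.
  have {}e : w' *~ det2 w m + w *~ det2 m w' = 0.
    by rewrite (det2C w m) (det2C m w') !mulrNz -opprD e oppr0.
  have {}e : w' *~ det2 w m = 0.
    by apply: pointedD e; apply: amZ => //; [apply: hwS | apply: hwS'].
  by apply: contraNeq w0' => /(mulrz_row0 e) ->.
have [u [pu [d d0 du]]] := primitive_normal w0.
have [v [[p pv] [d' d0' dv]]] := primitive_normal w0'.
have dv' m : d' * pairing m (- v) = det2 m w'.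
  by rewrite pairing_oppr mulrN dv -det2C.
have det2xx a : det2 a a = 0 by rewrite /det2; ring.
exists w, w', u, (- v); split => //.
- by move=> m Sm; rewrite -(pmulr_rge0 _ d0) du hwS.
- by move=> m Sm; rewrite -(pmulr_rge0 _ d0') dv' hwS'.
- by apply: (mulfI (lt0r_neq0 d0)); rewrite du mulr0.
- by apply: (mulfI (lt0r_neq0 d0')); rewrite dv' mulr0.
- by rewrite -(pmulr_rgt0 _ d0') dv'.
- by rewrite -(pmulr_rgt0 _ d0) du.
- by exists (- p); rewrite pairing_oppr pairingN opprK.
Qed.

End FrameExists.

Section FrameTheory.
Context (S : affine_monoid 2) (w w' u u' : 'rV[int]_2).
Context (F : frame S w w' u u').
Local Notation M := 'rV[int]_2.
Implicit Types (m : M).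

(** The pairings of [w], [w'] with [u], [u'] form an antidiagonal matrix with nonzero entries, so
    [u] and [u'] are linearly independent. *)
Lemma frame_inj m : pairing m u = 0 -> pairing m u' = 0 -> m = 0.
Proof.
move=> h h'.
have := frame_w0 F; have := frame_w0' F.
have := frame_gt0 F; have := frame_gt0' F.
move: h h'; rewrite !pairing2E.
set a := u 0 0; set b := u 0 1; set c := u' 0 0; set d := u' 0 1.
set x := m 0 0; set y := m 0 1.
set p := w 0 0; set q := w 0 1; set p' := w' 0 0; set q' := w' 0 1.
move=> h h' l'pos hpos h'0 l0.
have D0 : a * d - b * c != 0.
  apply: contraTneq l'pos => D0; rewrite -leNgt le_eqVlt; apply/orP; left.
  have e1 : (p * c + q * d) * (p' * a + q' * b) =
    (p' * c + q' * d) * (p * a + q * b) + (q * p' - p * q') * (a * d - b * c).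
    by ring.
  move: e1; rewrite h'0 l0 D0 mul0r mulr0 addr0 => /eqP.
  by rewrite mulf_eq0 (negPf (lt0r_neq0 hpos)) /=.
have ex : x * (a * d - b * c) = d * (x * a + y * b) - b * (x * c + y * d) by ring.
have ey : y * (a * d - b * c) = a * (x * c + y * d) - c * (x * a + y * b) by ring.
rewrite h h' !mulr0 subr0 in ex ey.
by apply: row2P; rewrite mxE; apply: (mulIf D0); rewrite mul0r.
Qed.

Lemma frame_eq m m' : pairing m u = pairing m' u ->
  pairing m u' = pairing m' u' -> m = m'.
Proof.
move=> h h'; apply/eqP; rewrite -subr_eq0; apply/eqP/frame_inj;
  by rewrite pairingB ?h ?h' subrr.
Qed.

(** Up to sign, the determinant of the pairings of [w], [w'] with [u], [u']. It is a common
    denominator for the coordinates of elements of [S] in terms of [w] and [w']. *)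
Definition frame_index : nat := absz (pairing w u' * pairing w' u).

Lemma frame_index_gt0 : (0 < frame_index)%N.
Proof. by rewrite absz_gt0 mulf_neq0 // lt0r_neq0 ?(frame_gt0 F) ?(frame_gt0' F). Qed.

Lemma frame_rel m : m \in S ->
  m *+ frame_index = w *+ absz (pairing m u' * pairing w' u)
                   + w' *+ absz (pairing m u * pairing w u').
Proof.
move=> Sm; have := frame_gt0 F; have := frame_gt0' F => p' p.
have hm := frame_ge0 F Sm; have hm' := frame_ge0' F Sm.
have e1 : frame_index%:Z = pairing w u' * pairing w' u.
  by rewrite gez0_abs // mulr_ge0 // ltW.
have e2 : (absz (pairing m u' * pairing w' u))%:Z = pairing m u' * pairing w' u.
  by rewrite gez0_abs // mulr_ge0 // ltW.
have e3 : (absz (pairing m u * pairing w u'))%:Z = pairing m u * pairing w u'.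
  by rewrite gez0_abs // mulr_ge0 // ltW.
apply: frame_eq; rewrite pairingD !pairingMn !mulrn_int e1 e2 e3.
  by rewrite (frame_w0 F); ring.
by rewrite (frame_w0' F); ring.
Qed.

End FrameTheory.

(** * Cotangent spaces and derivations at a point *)

Section Cotangent.
Context (k : fieldType).

Section Square.
Context (A : comAlgType k) (x : Defs.point A).

Lemma max_ideal_sq0 : max_ideal_sq x 0.
Proof.
exists 0%N, (fun=> 0), (fun=> 0); split; try by case.
by rewrite big_ord0.
Qed.

Lemma max_ideal_sqM f g : max_ideal x f -> max_ideal x g -> max_ideal_sq x (f * g).
Proof.
by move=> hf hg; exists 1%N, (fun=> f), (fun=> g); split=> //; rewrite big_ord1.
Qed.

Lemma max_ideal_sqD f g :
  max_ideal_sq x f -> max_ideal_sq x g -> max_ideal_sq x (f + g).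
Proof.
move=> [r [a [b [ha hb ->]]]] [r' [a' [b' [ha' hb' ->]]]].
pose c T (s : 'I_r -> T) (s' : 'I_r' -> T) i :=
  match fintype.split i with inl j => s j | inr j => s' j end.
exists (r + r')%N, (c _ a a'), (c _ b b'); split.
- by move=> i; rewrite /c; case: (fintype.split i).
- by move=> i; rewrite /c; case: (fintype.split i).
rewrite big_split_ord /=; congr (_ + _); apply: eq_bigr => i _.
  by rewrite /c (unsplitK (inl i)).
by rewrite /c (unsplitK (inr i)).
Qed.

Lemma max_ideal_sqZ (c : k) f : max_ideal_sq x f -> max_ideal_sq x (c *: f).
Proof.
move=> [r [a [b [ha hb ->]]]]; exists r, (fun i => c *: a i), b; split=> //.
  by move=> i; rewrite /max_ideal /= linearZ /= ha scaler0.
by rewrite scaler_sumr; apply: eq_bigr => i _; rewrite scalerAl.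
Qed.

(** The matrix of the values [D i (f j)] is an invertible diagonal matrix of size [r], and it
    factors through the [d]-dimensional cotangent space. *)
Lemma cotangent_dim_le d r (D : 'I_r -> {linear A -> k^o}) (f : 'I_r -> A) :
  cotangent_dim x d ->
  (forall i g, max_ideal_sq x g -> D i g = 0) ->
  (forall i, max_ideal x (f i)) ->
  (forall i j, (D i (f j) != 0) = (i == j)) -> (r <= d)%N.
Proof.
move=> [b [mb gen _]] D0 mf Df.
have [c hc] := choice (fun j => gen (f j) (mf j)).
pose C : 'M[k]_(r, d) := \matrix_(j, i) c j i.
pose B : 'M[k]_(d, r) := \matrix_(i, j) D j (b i).
pose E : 'rV[k]_r := \row_j D j (f j).
have CB : C *m B = diag_mx E.
  apply/matrixP => j i; rewrite !mxE.
  transitivity (D i (f j)).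
    apply/eqP; rewrite eq_sym -subr_eq0; apply/eqP.
    rewrite -[RHS](D0 i _ (hc j)) linearB /= linear_sum; congr (_ - _).
    by apply: eq_bigr => l _; rewrite !mxE linearZ.
  case: (eqVneq j i) => [->|ji]; first by rewrite mulr1n.
  by apply/eqP; rewrite mulr0n -[_ == _]negbK Df eq_sym.
have : \rank (diag_mx E) = r.
  apply: mxrank_unit; rewrite unitmxE det_diag unitfE.
  by apply/prodf_neq0 => i _; rewrite mxE Df.
rewrite -CB => <-; apply: leq_trans (mxrankM_maxl _ _) _; exact: rank_leq_col.
Qed.

Definition comp_point (g : aut A) : Defs.point A := x \o pullback g.

End Square.

Lemma cotangent_dim_aut (A : comAlgType k) (x : Defs.point A) (g : aut A) d :
  cotangent_dim (comp_point x g) d -> cotangent_dim x d.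
Proof.
move=> [b [mb gen free]].
have sq f : max_ideal_sq (comp_point x g) f -> max_ideal_sq x (pullback g f).
  move=> [r [a [c [ha hc ->]]]].
  exists r, (pullback g \o a), (pullback g \o c); split => //.
  by rewrite linear_sum; apply: eq_bigr => i _; rewrite rmorphM.
have sq' f : max_ideal_sq x f -> max_ideal_sq (comp_point x g) (pullback_inv g f).
  move=> [r [a [c [ha hc ->]]]].
  exists r, (pullback_inv g \o a), (pullback_inv g \o c); split.
  - by move=> i; rewrite /max_ideal /= pullback_invK; apply: ha.
  - by move=> i; rewrite /max_ideal /= pullback_invK; apply: hc.
  by rewrite linear_sum; apply: eq_bigr => i _; rewrite rmorphM.
have sumb c : pullback g (\sum_(i < d) c i *: b i) =
    \sum_(i < d) c i *: pullback g (b i).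
  by rewrite linear_sum; apply: eq_bigr => i _; rewrite linearZ.
exists (pullback g \o b); split => [i|f mf|c hc].
- exact: mb.
- have [|c hc] := gen (pullback_inv g f).
    by rewrite /max_ideal /= pullback_invK.
  by exists c; move/sq: hc; rewrite linearB /= pullback_invK sumb.
- by apply: free; rewrite -[X in max_ideal_sq _ X](pullbackK g) sumb; apply: sq'.
Qed.

Section Derivations.
Context (n : nat) (S : affine_monoid n).
Local Notation M := 'rV[int]_n.
Local Notation A := (monoid_algebra k S).
Context (x : Defs.point A).

Lemma point_expand (f : A) :
  x f = \sum_(m <- msupp (ma_val f)) (ma_val f)@_m * x (reg m).
Proof. exact: (lrmorph_expand x). Qed.

(* [d] defines a derivation [chi m |-> d m] of [k[S]] at [x]. *)
Definition derivation_at (d : M -> k) : Prop :=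
  forall a b, a \in S -> b \in S -> d (a + b) = x (reg a) * d b + x (reg b) * d a.

Definition derivation (d : M -> k) (f : A) : k^o := lext (d : M -> k^o) (ma_val f).

Lemma derivation_linear d : linear (derivation d).
Proof. by move=> c f g; rewrite /derivation ma_valZD lextZD. Qed.

HB.instance Definition _ d :=
  GRing.isLinear.Build k A k^o *:%R (derivation d) (derivation_linear d).

Lemma derivation_reg d m : m \in S -> derivation d (reg m) = d m.
Proof. by move=> Sm; rewrite /derivation reg_val // lext_chi. Qed.

Lemma derivationM d f g : derivation_at d ->
  derivation d (f * g) = x f * derivation d g + x g * derivation d f.
Proof.
move=> hd; rewrite {1}/derivation ma_valM lextM !point_expand /derivation /lext.
rewrite [X in _ + X]mulrC !mulr_suml -big_split /=.
apply: eq_big_seq => m /supp_in Sm; rewrite !mulr_sumr -big_split /=.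
apply: eq_big_seq => m' /supp_in Sm'; rewrite hd // /GRing.scale /=; ring.
Qed.

Lemma derivation_sq d f : derivation_at d -> max_ideal_sq x f -> derivation d f = 0.
Proof.
move=> hd [r [a [b [ha hb ->]]]]; rewrite linear_sum big1 // => i _.
by rewrite /= derivationM // ha hb !mul0r addr0.
Qed.

End Derivations.
End Cotangent.

(** * Smoothness of the open orbit *)

Section Smoothness.
Context (k : fieldType) (char0 : [pchar k] =i pred0).
Context (S : affine_monoid 2) (w w' u u' : 'rV[int]_2).
Context (F : frame S w w' u u').
Local Notation M := 'rV[int]_2.
Local Notation A := (monoid_algebra k S).
Implicit Types (m : M).

Lemma intr_eq0_char0 (z : int) : ((z%:~R : k) == 0) = (z == 0).
Proof.
have nat0 := (pcharf0P k).1 char0.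
by case: z => i; rewrite ?NegzE ?mulrNz ?oppr_eq0 -pmulrn nat0.
Qed.

Lemma frame_nz (x : Defs.point A) m : m \in S ->
  x (reg w) != 0 -> x (reg w') != 0 -> x (reg m) != 0.
Proof.
move=> Sm xw xw'; have Sw := frame_S F; have Sw' := frame_S' F.
apply/eqP => xm.
have := congr1 (fun m => x (reg m)) (frame_rel F Sm).
rewrite /= regD ?amMn // !regMn // rmorphM !rmorphXn /= xm expr0n.
rewrite eqn0Ngt (frame_index_gt0 F) //= => /esym/eqP; rewrite mulf_eq0.
by rewrite !expf_eq0 (negPf xw) (negPf xw') !andbF.
Qed.

Lemma scaler_split (V : lmodType k) (c d0 d1 c0 c1 r : k) (a b e : V) :
  (c * d0 + c0) *: a + (c * d1 + c1) *: b + (c + r) *: e =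
  (c *: (d0 *: a + d1 *: b) + c *: e) + (c0 *: a + c1 *: b + r *: e).
Proof.
rewrite !scalerDl scalerDr !scalerA.
by rewrite [(_ * _) *: a + _ + _]addrACA [LHS]addrACA.
Qed.

(** The function [e m], which is [chi m] divided by its value at [x], minus 1, behaves like a
    logarithm: [e (a + b) - (e a + e b)] is the product [e a * e b], a square-ideal element.
    Dividing [frame_rel] by the index, [e w] and [e w'] span; the derivations attached to [u] and
    [u'] show them independent. *)
Lemma torus_smooth (x : Defs.point A) :
  x (reg w) != 0 -> x (reg w') != 0 -> cotangent_dim x 2.
Proof.
move=> xw xw'; have Sw := frame_S F; have Sw' := frame_S' F.
pose v m : k := x (reg m).
have xne m : m \in S -> v m != 0 by move=> Sm; apply: frame_nz.
have xD a b : a \in S -> b \in S -> v (a + b) = v a * v b.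
  by move=> Sa Sb; rewrite /v regD // rmorphM.
pose e m : A := (v m)^-1 *: reg m - 1.
have em m : m \in S -> max_ideal x (e m).
  move=> Sm; rewrite /max_ideal /e /= linearB /= linearZ /= rmorph1 -/(v m).
  by rewrite /GRing.scale /= mulVf ?xne // subrr.
pose eqv (f g : A) := max_ideal_sq x (f - g).
have eqvT f g h : eqv f g -> eqv g h -> eqv f h.
  move=> h1 h2; rewrite /eqv -(subrK g f) -addrA.
  exact: max_ideal_sqD.
have eqvC f g : eqv f g -> eqv g f.
  by move=> h; rewrite /eqv -opprB -scaleN1r; apply: max_ideal_sqZ.
have eqvD f g f' g' : eqv f f' -> eqv g g' -> eqv (f + g) (f' + g').
  by move=> h1 h2; rewrite /eqv opprD addrACA; apply: max_ideal_sqD.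
have eqvZ (c : k) f g : eqv f g -> eqv (c *: f) (c *: g).
  by move=> h; rewrite /eqv -scalerBr; apply: max_ideal_sqZ.
have eqvR f : eqv f f by rewrite /eqv subrr; apply: max_ideal_sq0.
have eD a b : a \in S -> b \in S -> eqv (e (a + b)) (e a + e b).
  move=> Sa Sb; rewrite /eqv.
  have -> : e (a + b) - (e a + e b) = e a * e b.
    rewrite /e regD // xD // invfM -scalerA scalerAr scalerAl.
    have ringE (R : comNzRingType) (p q : R) :
      p * q - 1 - (p - 1 + (q - 1)) = (p - 1) * (q - 1) by ring.
    exact: ringE.
  by apply: max_ideal_sqM; apply: em.
have e0 : e 0 = 0 by rewrite /e /v reg0 rmorph1 invr1 scale1r subrr.
have eMn a i : a \in S -> eqv (e (a *+ i)) (i%:R *: e a).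
  move=> Sa; elim: i => [|i IH]; first by rewrite mulr0n e0 scale0r.
  rewrite mulrS -nat1r scalerDl scale1r.
  by apply: (eqvT _ _ _ (eD _ _ Sa (amMn i Sa))); apply: (eqvD).
have nat0 := (pcharf0P k).1 char0.
have egen m : m \in S -> exists c0 c1 : k, eqv (e m) (c0 *: e w + c1 *: e w').
  move=> Sm; have rel := frame_rel F Sm; move: rel.
  set i := absz _; set j := absz _; set N := frame_index _ _ _ _ => rel.
  have N0 : (N%:R : k) != 0 by rewrite nat0 -lt0n (frame_index_gt0 F).
  exists (N%:R^-1 * i%:R), (N%:R^-1 * j%:R).
  rewrite -!scalerA -scalerDr -[e m](scalerK N0); apply: eqvZ.
  apply: (eqvT); first by apply: (eqvC); apply: (eMn).
  rewrite rel.
  apply: (eqvT); first by apply: (eD); apply: amMn.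
  by apply: (eqvD); apply: (eMn).
pose b (i : 'I_2) := if i == 0 then e w else e w'.
pose pr (c0 c1 : k) (i : 'I_2) := if i == 0 then c0 else c1.
have sumb c : \sum_(i < 2) c i *: b i = c 0 *: e w + c 1 *: e w'.
  rewrite big_ord_recl big_ord1 (_ : lift ord0 ord0 = 1); last exact: val_inj.
  by [].
exists b; split.
- by move=> i; rewrite /b; case: ifP => _; apply: em.
- move=> f mf; suff [c0 [c1 h]] : exists c0 c1 : k, eqv f (c0 *: e w + c1 *: e w').
    by exists (pr c0 c1); rewrite sumb.
  (* The scalar remainder collects the values of the terms at [x]. Over the whole support it is
     [x f], which vanishes for [f] in the maximal ideal. *)
  have sum (s : seq M) : {subset s <= S} -> exists c0 c1 : k,
    eqv (\sum_(m <- s) (ma_val f)@_m *: reg m)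
      (c0 *: e w + c1 *: e w' + ((\sum_(m <- s) (ma_val f)@_m * v m)%:A : A)).
    elim: s => [|m s IH] sub.
      by exists 0, 0; rewrite !big_nil !scale0r !addr0.
    have Sm : m \in S by apply: sub; rewrite inE eqxx.
    have [|c0 [c1 h]] := IH; first by move=> y ys; apply: sub; rewrite inE ys orbT.
    have [d0 [d1 h']] := egen _ Sm.
    pose c := (ma_val f)@_m * v m.
    exists (c * d0 + c0), (c * d1 + c1); rewrite !big_cons -/c.
    have -> : (ma_val f)@_m *: reg m = c *: e m + (c%:A : A).
      rewrite /e scalerBr subrK scalerA /c -mulrA mulfV ?mulr1 //.
      exact: xne.
    have -> : (c * d0 + c0) *: e w + (c * d1 + c1) *: e w' +
        (c + \sum_(m <- s) (ma_val f)@_m * v m)%:A =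
      (c *: (d0 *: e w + d1 *: e w') + c%:A) + (c0 *: e w + c1 *: e w' +
         ((\sum_(m <- s) (ma_val f)@_m * v m)%:A : A)).
      exact: scaler_split.
    by apply: (eqvD) => //; apply: (eqvD) => //; apply: (eqvZ).
  have [|c0 [c1 h]] := sum (enum_fset (msupp (ma_val f))).
    by move=> m /supp_in.
  exists c0, c1; move: h; rewrite -ma_expand -point_expand mf scale0r addr0.
  by [].
- move=> c; rewrite sumb => hc.
  have der z : derivation_at x (fun m => v m * (pairing m z)%:~R).
    by move=> a a' Sa Sa'; rewrite xD // pairingD rmorphD /=; ring.
  have dere z m : m \in S ->
      derivation (fun m => v m * (pairing m z)%:~R) (e m) = (pairing m z)%:~R :> k.
    move=> Sm; rewrite /e linearB linearZ /= -(reg0 k S) !derivation_reg ?am0 //.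
    by rewrite pairing0 mulr0 subr0 /GRing.scale /= mulKf // xne.
  have c0 : c 0 = 0.
    have := derivation_sq (der u') hc.
    rewrite linearD !linearZ /= !dere // (frame_w0' F) scaler0 addr0 => /eqP.
    by rewrite mulf_eq0 intr_eq0_char0 (negPf (lt0r_neq0 (frame_gt0 F))) orbF => /eqP.
  have c1 : c 1 = 0.
    have := derivation_sq (der u) hc.
    rewrite linearD !linearZ /= !dere // (frame_w0 F) scaler0 add0r => /eqP.
    by rewrite mulf_eq0 intr_eq0_char0 (negPf (lt0r_neq0 (frame_gt0' F))) orbF => /eqP.
  case=> [[|[|//]]] lt.
    by rewrite -[RHS]c0; congr c; apply: val_inj.
  by rewrite -[RHS]c1; congr c; apply: val_inj.
Qed.

End Smoothness.

(** * The smooth boundary curve *)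

Section Boundary.
Context (k : fieldType) (char0 : [pchar k] =i pred0).
Context (S : affine_monoid 2) (w w' u u' : 'rV[int]_2).
Context (F : frame S w w' u u').
Local Notation M := 'rV[int]_2.
Local Notation A := (monoid_algebra k S).
Implicit Types (m n q a b : M).

(** The distinguished point of the one-dimensional orbit attached to the facet. The indicator of the
    facet is multiplicative because [pairing _ u] is nonnegative on [S]. *)
Lemma boundary_point : exists x : Defs.point A,
  forall m, m \in S -> x (reg m) = (pairing m u == 0)%:R.
Proof.
apply: (@ma_lift _ _ _ k^o (fun m => (pairing m u == 0)%:R)).
  by rewrite pairing0 eqxx.
move=> a b Sa Sb; rewrite pairingD paddr_eq0 ?(frame_ge0 F) //.
by case: eqP; case: eqP => _ _; rewrite /= ?mulr0 ?mul0r ?mulr1.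
Qed.

Definition in_facet n : Prop := n \in S /\ pairing n u = 0.

Lemma in_facetD n n' : in_facet n -> in_facet n' -> in_facet (n + n').
Proof.
by move=> [Sn n0] [Sn' n0']; split; rewrite ?amD // pairingD n0 n0' addr0.
Qed.

Lemma in_facet0 : in_facet 0.
Proof. by split; rewrite ?am0 ?pairing0. Qed.

(** Equality modulo the group generated by the facet elements. Both sides are corrected because
    negatives of facet elements need not lie in [S]. *)
Definition eqv_facet m m' : Prop :=
  exists n n', [/\ in_facet n, in_facet n' & m + n = m' + n'].

Lemma eqv_facet_refl m : eqv_facet m m.
Proof. by exists 0, 0; split; try exact: in_facet0. Qed.

Lemma eqv_facet_sym m m' : eqv_facet m m' -> eqv_facet m' m.
Proof. by move=> [n [n' [h h' e]]]; exists n', n. Qed.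

Lemma eqv_facet_trans m1 m2 m3 :
  eqv_facet m1 m2 -> eqv_facet m2 m3 -> eqv_facet m1 m3.
Proof.
move=> [n [n' [h h' e]]] [p [p' [g g' e']]].
exists (n + p), (p' + n'); split; try exact: in_facetD.
by rewrite addrA e addrAC e' addrA.
Qed.

Lemma eqv_facetD a b a' b' :
  eqv_facet a a' -> eqv_facet b b' -> eqv_facet (a + b) (a' + b').
Proof.
move=> [n [n' [h h' e]]] [p [p' [g g' e']]].
exists (n + p), (n' + p'); split; try exact: in_facetD.
by rewrite addrACA e e' addrACA.
Qed.

Lemma eqv_facet_add a n : in_facet n -> eqv_facet (a + n) a.
Proof.
by move=> h; exists 0, n; split; rewrite ?addr0 //; apply: in_facet0.
Qed.

Lemma eqv_facet_pairing m m' : eqv_facet m m' -> pairing m u = pairing m' u.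
Proof.
move=> [n [n' [[_ h] [_ h'] /(congr1 (fun m => pairing m u))]]].
by rewrite !pairingD h h' !addr0.
Qed.

Definition irreducible_over_facet q : Prop :=
  [/\ q \in S, 0 < pairing q u & forall a b, a \in S -> b \in S ->
     0 < pairing a u -> 0 < pairing b u -> ~ eqv_facet q (a + b)].

(* Each irreducible class modulo the facet, and the direction along the facet,
   contributes a dimension to the cotangent space. *)
Lemma irreducible_over_facet_uniq (x : Defs.point A) q q' :
  (forall m, m \in S -> x (reg m) = (pairing m u == 0)%:R) ->
  cotangent_dim x 2 -> irreducible_over_facet q -> irreducible_over_facet q' ->
  eqv_facet q q'.
Proof.
move=> xE x2 [Sq q0 qI] [Sq' q0' qI']; apply: contrapT => neq.
have Sw := frame_S F.
pose d0 m : k := if pairing m u == 0 then (pairing m u')%:~R else 0.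
pose dq q m : k := (`[< eqv_facet m q >])%:R.
have dqT m q1 : eqv_facet m q1 -> dq q1 m = 1 by move=> h; rewrite /dq asboolT.
have dqF m q1 : ~ eqv_facet m q1 -> dq q1 m = 0 by move=> h; rewrite /dq asboolF.
have d0P : derivation_at x d0.
  move=> a b Sa Sb; rewrite /d0 !xE // pairingD paddr_eq0 ?(frame_ge0 F) //.
  case: eqP => ha; case: eqP => hb; rewrite /= ?mul1r ?mul0r ?mulr0 ?addr0 //.
  by rewrite pairingD rmorphD addrC.
(* The indicator of an irreducible class obeys the Leibniz rule: adding a facet element does not
   change the class, and a sum of two elements off the facet is never in it. *)
have dqP q1 : irreducible_over_facet q1 -> derivation_at x (dq q1).
  move=> [Sq1 q1pos q1I] a b Sa Sb; rewrite !xE //.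
  have facet0 c : pairing c u = 0 -> dq q1 c = 0.
    by move=> hc; apply: dqF => /eqv_facet_pairing e; rewrite -e hc ltxx in q1pos.
  have facetD c n : in_facet n -> dq q1 (c + n) = dq q1 c.
    move=> hn; congr (_%:R); congr (nat_of_bool _); apply: asbool_equiv_eq.
    have e := eqv_facet_add c hn; split; apply: eqv_facet_trans => //.
    exact: eqv_facet_sym.
  case: eqP => ha; case: eqP => hb.
  - by rewrite !facet0 ?pairingD ?ha ?hb ?addr0 // !mulr0 addr0.
  - by rewrite (facet0 a) // addrC facetD // mulr0 mul1r addr0.
  - by rewrite (facet0 b) // facetD // mulr0 mul1r add0r.
  - rewrite !mul0r addr0; apply: dqF => /eqv_facet_sym.
    by apply: q1I => //; rewrite lt_def (frame_ge0 F) // andbT; apply/eqP.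
pose d (i : 'I_3) := if i == 0 then d0 else if i == 1 then dq q else dq q'.
pose f (i : 'I_3) : A := if i == 0 then reg w - 1 else if i == 1 then reg q else reg q'.
suff : (3 <= 2)%N by [].
apply: (@cotangent_dim_le _ _ x 2 3 (fun i => derivation (d i)) f x2).
- move=> i g; apply: derivation_sq; rewrite /d.
  by case: ifP => // _; case: ifP => _; apply: dqP.
- move=> i; rewrite /f /max_ideal /=; case: ifP => _.
    by rewrite rmorphB rmorph1 /= xE // (frame_w0 F) eqxx subrr.
  by case: ifP => _; rewrite xE // gt_eqF.
move=> i j; rewrite /d /f.
have w1 e : e 0 = 0 -> derivation e (reg w - 1 : A) = e w.
  move=> e0; rewrite linearB /= -(reg0 k S) !derivation_reg ?am0 //.
  by rewrite e0 subr0.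
have w0q q1 : pairing q1 u != 0 -> dq q1 w = 0 /\ dq q1 0 = 0.
  move=> h; split; apply: dqF => /eqv_facet_pairing; rewrite ?(frame_w0 F) ?pairing0;
    by move/esym/eqP; apply/negP.
have [wq q0'0] := w0q _ (lt0r_neq0 q0); have [wq' q'0] := w0q _ (lt0r_neq0 q0').
have d00 : d0 0 = 0 by rewrite /d0 !pairing0 eqxx.
have d0w : d0 w != 0.
  by rewrite /d0 (frame_w0 F) eqxx intr_eq0_char0 // lt0r_neq0 // (frame_gt0 F).
have [d0q d0q'] : d0 q = 0 /\ d0 q' = 0 by rewrite /d0 !gt_eqF.
have dqq' : dq q q' = 0 by apply: dqF => /eqv_facet_sym.
have dq'q : dq q' q = 0 by apply: dqF.
have dqq : dq q q != 0 by rewrite dqT ?oner_eq0 //; apply: eqv_facet_refl.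
have dqq'' : dq q' q' != 0 by rewrite dqT ?oner_eq0 //; apply: eqv_facet_refl.
case: i => [[|[|[|//]]] ?]; case: j => [[|[|[|//]]] ?]; rewrite -!val_eqE /=;
  by rewrite ?w1 ?derivation_reg ?d0q ?d0q' ?dqq' ?dq'q ?wq ?wq' ?eqxx.
Qed.

(** Induction on [pairing m u] splits every element of [S] into irreducible classes, which all
    coincide with that of [a]. Thus [pairing a u] divides every pairing with [u], first on [S] and
    then on the lattice, and primitivity of [u] makes it 1. *)
Lemma smooth_boundary (x : Defs.point A) :
  (forall m, m \in S -> x (reg m) = (pairing m u == 0)%:R) ->
  cotangent_dim x 2 ->
  exists a, [/\ a \in S, pairing a u = 1
    & forall m, m \in S -> eqv_facet m (a *+ `|pairing m u|%N)].
Proof.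
move=> xE x2.
have split_irr m : m \in S -> 0 < pairing m u -> irreducible_over_facet m \/
    exists a b, [/\ a \in S, b \in S, 0 < pairing a u, 0 < pairing b u &
      eqv_facet m (a + b)].
  move=> Sm m0; case: (pselect (irreducible_over_facet m)) => h; first by left.
  right; apply: contrapT => h'; apply: h; split=> // a b Sa Sb a0 b0 e.
  by apply: h'; exists a, b.
have [a aI] : exists a, irreducible_over_facet a.
  have Sw' := frame_S' F; have := frame_gt0' F.
  move: {2}(`|_|)%N (leqnn `|pairing w' u|%N) Sw' => i.
  elim: i w' => [|i IH] m lei Sm m0; first by move: lei m0; lia.
  case: (split_irr m) => // [|[a [b [Sa Sb a0 b0 /eqv_facet_pairing]]]]; first by exists m.
  rewrite pairingD => e; apply: (IH a) => //; lia.
have [Sa a0 aI'] := aI.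
have all i m : (absz (pairing m u) <= i)%N -> m \in S ->
    exists j, eqv_facet m (a *+ j).
  elim: i m => [|i IH] m lei Sm.
    exists 0%N; apply: eqv_facet_sym; rewrite mulr0n -[X in eqv_facet _ X]add0r.
    apply/eqv_facet_sym/eqv_facet_add; split=> //; lia.
  case: (ltrP 0 (pairing m u)) => [m0|m0]; last first.
    by apply: IH => //; have := frame_ge0 F Sm; lia.
  case: (split_irr m) => // [mI|[b [c [Sb Sc b0 c0 e]]]].
    by exists 1%N; rewrite mulr1n; apply: (irreducible_over_facet_uniq xE x2).
  have := eqv_facet_pairing e; rewrite pairingD => e'.
  have [||j hj] := IH b => //; first by lia.
  have [||j' hj'] := IH c => //; first by lia.
  exists (j + j')%N; rewrite mulrnDr; apply: eqv_facet_trans e _.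
  exact: eqv_facetD.
have dvd m : (pairing a u %| pairing m u)%Z.
  have dvdS n : n \in S -> (pairing a u %| pairing n u)%Z.
    move=> Sn; have [j /eqv_facet_pairing->] := all _ _ (leqnn _) Sn.
    by rewrite pairingMn -mulr_natr dvdz_mulr.
  have [b [c [Sb Sc ->]]] := am_diff S m.
  by rewrite pairingB rpredB //; apply: dvdS.
have a1 : pairing a u = 1.
  have [p p1] := frame_prim F; move: (dvd p); rewrite p1 dvdz1 => /eqP; lia.
exists a; split=> // m Sm; have [j hj] := all _ _ (leqnn _) Sm.
suff -> : absz (pairing m u) = j by [].
by rewrite (eqv_facet_pairing hj) pairingMn a1 -[1 *+ j]/(j%:R) natz.
Qed.

End Boundary.

(** * Automorphisms from characters, and lexicographic orders *)

Section TorusAut.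
Context (k : fieldType) (n : nat) (S : affine_monoid n).
Local Notation M := 'rV[int]_n.
Local Notation A := (monoid_algebra k S).

Lemma character_aut (t : M -> k) : t 0 = 1 ->
  (forall a b, t (a + b) = t a * t b) ->
  exists g : aut A, forall m, m \in S -> pullback g (reg m) = t m *: reg m.
Proof.
move=> t0 tD; have tN m : t m * t (- m) = 1 by rewrite -tD subrr.
have mul (s : M -> k) : s 0 = 1 -> (forall a b, s (a + b) = s a * s b) ->
    (s 0 *: reg 0 = 1 :> A) /\ forall a b, a \in S -> b \in S ->
    s (a + b) *: reg (a + b) = s a *: reg a * (s b *: reg b) :> A.
  move=> s0 sD; split; first by rewrite s0 reg0 scale1r.
  by move=> a b Sa Sb; rewrite sD regD // -scalerAr -scalerAl scalerA mulrC.
have [G0 GD] := mul t t0 tD.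
have [|a b|G0' GD'] := mul (fun m => t (- m)); first by rewrite oppr0.
  by rewrite opprD tD.
apply: (aut_lift G0 G0' GD GD') => F FE m Sm; rewrite linearZ /= FE // scalerA.
  by rewrite mulrC tN scale1r.
by rewrite tN scale1r.
Qed.

End TorusAut.

Section LexCone.
Context (S : affine_monoid 2) (w w' u u' : 'rV[int]_2) (F : frame S w w' u u').

Definition lex_pos (v v' : 'rV[int]_2) : pred 'rV[int]_2 := fun m =>
  (0 < pairing m v) || (pairing m v == 0) && (0 < pairing m v').

Lemma lex_pos_cone v : v = u' \/ v = - u' -> positive_cone (lex_pos u v).
Proof.
move=> hv; have inj m : pairing m u = 0 -> pairing m v = 0 -> m = 0.
  case: hv => -> h; first exact: (frame_inj F).
  by rewrite pairing_oppr => /eqP; rewrite oppr_eq0 => /eqP; apply: (frame_inj F).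
split.
- by move=> a b; rewrite /lex_pos !pairingD; lia.
- by rewrite /lex_pos !pairing0 ltxx andbF.
move=> a; case: (eqVneq a 0) => //= a0; rewrite /lex_pos !pairingN.
by case: (pairing a u =P 0) => h; case: (pairing a v =P 0) => h';
  [case/eqP: a0; apply: inj | lia | lia | lia].
Qed.

End LexCone.

(** * The ideal of the singular curve *)

Section SingularLocus.
Context (k : fieldType) (char0 : [pchar k] =i pred0).
Context (S : affine_monoid 2) (w w' u u' : 'rV[int]_2).
Context (F : frame S w w' u u').
Local Notation M := 'rV[int]_2.
Local Notation A := (monoid_algebra k S).
Implicit Types (m n q a b : M) (f : A).

(** By [frame_rel], a power of [chi m] is divisible by [chi w] as soon as [pairing m u'] is
    positive. *)
Lemma point_w_eq0 (x : Defs.point A) m :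
  x (reg w) = 0 -> m \in S -> 0 < pairing m u' -> x (reg m) = 0.
Proof.
have Sw := frame_S F; have Sw' := frame_S' F.
move=> xw Sm m0; have := congr1 (fun m => x (reg m)) (frame_rel F Sm).
have := frame_gt0' F => p'.
rewrite /= regD ?amMn // !regMn // rmorphM !rmorphXn /= xw.
rewrite [X in X * _]expr0n absz_eq0 mulf_eq0 !gt_eqF //= mul0r => /eqP.
by rewrite expf_eq0 => /andP[_ /eqP].
Qed.

(** On the facet of [w'] the [w]-term of [frame_rel] disappears, so a power of [chi m] is a power of
    [chi w']. *)
Lemma point_w'_neq0 (x : Defs.point A) m :
  x (reg w') != 0 -> m \in S -> pairing m u' = 0 -> x (reg m) != 0.
Proof.
have Sw := frame_S F; have Sw' := frame_S' F.
move=> xw Sm m0; have := congr1 (fun m => x (reg m)) (frame_rel F Sm).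
rewrite m0 mul0r mulr0n add0r /= !regMn // !rmorphXn /=.
move=> e; apply/eqP => xm; move/eqP: e; rewrite xm expr0n.
rewrite eqn0Ngt (frame_index_gt0 F) eq_sym expf_eq0 (negPf xw) andbF.
by [].
Qed.

Lemma poly_nat_roots (p : {poly k}) : (forall i, p.[i.+1%:R] = 0) -> p = 0.
Proof.
move=> h; apply/eqP; apply: contraT => p0.
have inj : injective (fun i => i.+1%:R : k).
  move=> i j /eqP; rewrite -subr_eq0.
  have -> : (i.+1%:R - j.+1%:R : k) = (i.+1%:Z - j.+1%:Z)%:~R.
    by rewrite rmorphB /= !pmulrn.
  by rewrite intr_eq0_char0 // subr_eq0 => /eqP[].
have := @max_poly_roots _ p [seq i.+1%:R | i <- iota 0 (size p)] p0.
rewrite map_inj_uniq // iota_uniq size_map size_iota ltnn => H.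
by apply: H => //; apply/allP => _ /mapP[i _ ->]; apply/rootP.
Qed.

Let sing := singular_locus A 2.

Lemma sing_comp (g : aut A) (x : Defs.point A) : sing x -> sing (comp_point x g).
Proof. by move=> hx h; apply: hx; apply: cotangent_dim_aut h. Qed.

Context (sing_w : forall x, sing x -> x (reg w) = 0).
Context (x1 : Defs.point A) (sing_x1 : sing x1) (x1w' : x1 (reg w') != 0).

(** For the forward direction, the one-parameter subgroup given by [u] moves [x1] inside the
    singular locus, so vanishing there says that a polynomial in the parameter has every positive
    integer as a root. A term with [pairing m u' = 0] would be alone in its degree: terms with
    positive pairing vanish at [x1], and the two pairings determine the exponent. *)
Lemma vanish_singP f : (forall x, sing x -> x f = 0) <->
  (forall m, m \in msupp (ma_val f) -> 0 < pairing m u').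
Proof.
split=> [h|h x sx]; last first.
  rewrite point_expand big_seq big1 // => m hm.
  by rewrite (point_w_eq0 (sing_w sx)) ?mulr0 ?h // (supp_in hm).
have aut_s (s : k) : s != 0 -> exists g : aut A,
    forall m, m \in S -> pullback g (reg m) = s ^ pairing m u *: reg m.
  move=> s0; apply: (@character_aut _ _ _ (fun m => s ^ pairing m u)).
    by rewrite pairing0.
  by move=> a b; rewrite pairingD expfzDr.
pose p : {poly k} := \sum_(m <- msupp (ma_val f))
  ((ma_val f)@_m * x1 (reg m)) *: 'X^(absz (pairing m u)).
have p0 : p = 0.
  apply: poly_nat_roots => i; set s : k := i.+1%:R.
  have [|g gE] := aut_s s; first by rewrite ((pcharf0P k).1 char0).
  rewrite -[RHS](h _ (@sing_comp g _ sing_x1)) point_expand /p horner_sum.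
  apply: eq_big_seq => m /supp_in Sm.
  rewrite hornerZ hornerXn /comp_point /= gE // linearZ /= /GRing.scale /=.
  rewrite mulrAC mulrA; congr (_ * _ * _).
  by rewrite -[in RHS](gez0_abs (frame_ge0 F Sm)) exprnP.
move=> m hm; have Sm := supp_in hm; rewrite lt_def (frame_ge0' F) // andbT.
apply/eqP => m0; move/(congr1 (fun q : {poly k} => q`_(absz (pairing m u)))): p0.
rewrite coef0 /p coef_sum (big_fsetD1 m) //= coefZ coefXn eqxx mulr1.
rewrite big_seq big1 => [|a]; last first.
  rewrite !inE => /andP[am ha]; have Sa := supp_in ha; rewrite coefZ coefXn.
  case: (eqVneq (pairing a u') 0) => a0; last first.
    rewrite (point_w_eq0 (sing_w sing_x1)) ?mulr0 ?mul0r //.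
    by rewrite lt_def a0 (frame_ge0' F).
  case: eqP => e; last by rewrite mulr0.
  case/negP: am; apply/eqP/(frame_eq F); last by rewrite a0 m0.
  by rewrite -(gez0_abs (frame_ge0 F Sa)) -e gez0_abs ?(frame_ge0 F).
rewrite addr0 => /eqP; rewrite mulf_eq0 mcoeff_eq0 hm /=.
by apply/negP/point_w'_neq0.
Qed.

(** The preceding equivalence describes this monomial ideal by a locus that every automorphism
    preserves. *)
Lemma vanish_sing_aut (g : aut A) f :
  (forall m, m \in msupp (ma_val f) -> 0 < pairing m u') ->
  (forall m, m \in msupp (ma_val (pullback g f)) -> 0 < pairing m u').
Proof.
move=> /vanish_singP h; apply/vanish_singP => x sx.
exact: (h _ (@sing_comp g _ sx)).
Qed.

End SingularLocus.

(** * Facet monomials are eigenvectors of every automorphism *)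

Section FacetFixed.
Context (k : fieldType) (S : affine_monoid 2) (w w' u u' : 'rV[int]_2).
Context (F : frame S w w' u u').
Local Notation M := 'rV[int]_2.
Local Notation A := (monoid_algebra k S).
Local Notation in_facet := (in_facet S u).
Implicit Types (m n a b : M) (f : A) (g : aut A).

Lemma frame_facet n : in_facet n -> 0 < pairing n u' -> frame S n w' u u'.
Proof. by move=> [Sn n0]; case: F. Qed.

(** [n] may replace [w] in the frame, so [frame_rel] makes a power of each such monomial a multiple
    of [chi n]. Sums follow since the radical of an ideal is closed under addition. *)
Lemma radical_facet n f : in_facet n -> 0 < pairing n u' ->
  (forall m, m \in msupp (ma_val f) -> 0 < pairing m u') ->
  exists N q, f ^+ N = reg n * q.
Proof.
move=> hn n0 hf; have Fn := frame_facet hn n0; have Sn := hn.1.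
pose J f := exists N q, f ^+ N = reg n * q :> A.
have J0 : J 0 by exists 1%N, 0; rewrite mulr0 expr1.
have JD f1 f2 : J f1 -> J f2 -> J (f1 + f2).
  move=> [N1 [q1 e1]] [N2 [q2 e2]].
  have sum (T : comNzRingType) (x y z q1' q2' : T) : x ^+ N1 = z * q1' ->
      y ^+ N2 = z * q2' -> exists q, (x + y) ^+ (N1 + N2) = z * q.
    move=> h1 h2; rewrite exprDn.
    elim/big_ind: _ => [|s t [p ->] [p' ->]|i _].
    - by exists 0; rewrite mulr0.
    - by exists (p + p'); rewrite mulrDr.
    (* Each term of the binomial expansion contains [y] to a power at least [N2] or [x] to a power
       at least [N1]. *)
    case: (leqP N2 i) => hi.
      exists (x ^+ (N1 + N2 - i) * (q2' * y ^+ (i - N2)) *+ 'C(N1 + N2, i)).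
      by rewrite -(subnK hi) exprD h2 addnK -!mulrnAr; ring.
    have h3 : (N1 <= N1 + N2 - i)%N by lia.
    exists (q1' * x ^+ (N1 + N2 - i - N1) * y ^+ i *+ 'C(N1 + N2, i)).
    by rewrite -{1}(subnK h3) exprD h1 -!mulrnAr; ring.
  by have [q hq] := sum _ _ _ _ _ _ e1 e2; exists (N1 + N2)%N, q.
have Jt (c : k) m : m \in S -> 0 < pairing m u' -> J (c *: reg m).
  move=> Sm m0; exists (frame_index n w' u u').
  have := frame_rel Fn Sm; set i := absz _; set j := absz _ => e.
  have i0 : (0 < i)%N.
    by rewrite absz_gt0 mulf_neq0 // lt0r_neq0 // (frame_gt0' F).
  exists (c ^+ frame_index n w' u u' *: (reg (n *+ i.-1) * reg (w' *+ j))).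
  have Sw' := frame_S' F.
  rewrite exprZn -regMn // e -{1}(prednK i0) mulrS.
  rewrite -addrA !regD ?amD ?amMn //; exact: scalerAr.
have -> : f = \sum_(m <- msupp (ma_val f)) (ma_val f)@_m *: reg m by exact: ma_expand.
suff : forall s : seq M, {subset s <= msupp (ma_val f)} ->
    J (\sum_(m <- s) (ma_val f)@_m *: reg m) by apply.
elim=> [|m s IH] sub; first by rewrite big_nil.
rewrite big_cons; apply: JD.
  have hm : m \in msupp (ma_val f) by apply: sub; rewrite inE eqxx.
  by apply: Jt; [apply: supp_in hm | apply: hf].
by apply: IH => y ys; apply: sub; rewrite inE ys orbT.
Qed.

Context (pres : forall g f,
  (forall m, m \in msupp (ma_val f) -> 0 < pairing m u') ->
  (forall m, m \in msupp (ma_val (pullback g f)) -> 0 < pairing m u')).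

Lemma supp_reg m a : m \in S -> a \in msupp (ma_val (reg m : A)) -> a = m.
Proof. by move=> Sm; rewrite reg_val // => /msupp_chi. Qed.

(** The preserved ideal contains the image of [chi n] under the inverse of [g], so a power of that
    image is a multiple of [chi n]. Applying [g] shows that the image of [chi n] divides a monomial
    on the facet; its exponent lies on the facet as [pairing _ u] is nonnegative and additive. *)
Lemma facet_image g n : in_facet n -> exists (c : k) n',
  [/\ c != 0, in_facet n' & pullback g (reg n) = c *: reg n'].
Proof.
move=> hn; have [Sn n0] := hn.
case: (eqVneq (pairing n u') 0) => nu'.
  have -> : n = 0 by apply: (frame_inj F).
  exists 1, 0; split; rewrite ?oner_eq0 ?scale1r ?reg0 ?rmorph1 //.
  exact: in_facet0.
have npos : 0 < pairing n u' by rewrite lt_def nu' (frame_ge0' F).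
have [|N [q e]] := @radical_facet n (pullback g^-1%g (reg n)) hn npos.
  by apply: pres => m /(supp_reg Sn) ->.
have {}e : ma_val (pullback g (reg n)) * ma_val (pullback g q) = chi (n *+ N).
  rewrite -ma_valM -rmorphM -e rmorphXn /= pullback_invK -regMn //.
  by rewrite reg_val // amMn.
have [c [d [a [b [c0 ea eb ab]]]]] :=
  mul_eq_chi (lex_pos_cone F (or_introl erefl)) e.
have d0 : d != 0.
  apply: contraTneq (chi_neq0 k (n *+ N)) => d0.
  by rewrite -e eb d0 scale0r mulr0 eqxx.
have inS (f : A) c' a' : c' != 0 -> ma_val f = c' *: chi a' -> a' \in S.
  move=> c'0 ef; apply: (@supp_in k 2 S f); rewrite ef -mcoeff_neq0 mcoeffZ.
  by rewrite mcoeff_chi eqxx mulr1.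
have Sa := inS _ _ _ c0 ea; have Sb := inS _ _ _ d0 eb.
have au : pairing a u = 0.
  have := congr1 (fun m => pairing m u) ab; rewrite pairingD pairingMn n0 mul0rn.
  by have := frame_ge0 F Sa; have := frame_ge0 F Sb; lia.
exists c, a; split=> //; apply: ma_val_inj.
rewrite ma_valZ.
rewrite (reg_val k Sa).
exact: ea.
Qed.

Lemma mcoeff_scale_reg (c : k) a b : a \in S ->
  (ma_val (c *: reg a : A))@_b = c * (a == b)%:R.
Proof. by move=> Sa; rewrite ma_valZ reg_val // mcoeffZ mcoeff_chi. Qed.

Lemma scale_reg_inj (c d : k) a b : a \in S -> b \in S -> c != 0 ->
  c *: reg a = d *: reg b :> A -> a = b.
Proof.
move=> Sa Sb c0 e; have := mcoeff_scale_reg c a Sa.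
rewrite e (mcoeff_scale_reg d a Sb) {e} eqxx mulr1.
by case: eqP => // _ /esym/eqP; rewrite mulr0 (negPf c0).
Qed.

(** Take [a] on the facet with the least positive pairing with [u']: its image cannot have a smaller
    one. As [n] and [a] are proportional, both pairings are scaled by the same ratio. *)
Lemma facet_image_ge g n (c : k) n' : in_facet n -> in_facet n' -> c != 0 ->
  pullback g (reg n) = c *: reg n' -> pairing n u' <= pairing n' u'.
Proof.
move=> hn hn' c0 gn.
have ge0 a : in_facet a -> 0 <= pairing a u' by case=> Sa _; apply: (frame_ge0' F).
have ex : exists i, `[< exists2 a, in_facet a & pairing a u' = i.+1%:Z >].
  exists (absz (pairing w u')).-1; apply/asboolP; exists w.
    by split; [apply: (frame_S F) | apply: (frame_w0 F)].
  by have := frame_gt0 F; lia.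
case: (ex_minnP ex) => i /asboolP[a ha ai] imin.
have amin b : in_facet b -> 0 < pairing b u' -> pairing a u' <= pairing b u'.
  move=> hb b0; rewrite ai; have := imin (absz (pairing b u')).-1.
  case: asboolP => [_ /(_ isT)|[]]; first by lia.
  by exists b => //; lia.
have [d [a' [d0 ha' ga]]] := facet_image g ha.
(* Otherwise [a' = 0] and [g] sends [chi a] to a constant; applying the inverse of [g] makes [chi a]
   itself constant. *)
have a'0 : 0 < pairing a' u'.
  rewrite lt_def ge0 // andbT; apply/eqP => h.
  have a'0 : a' = 0 by apply: (frame_inj F) h; case: ha'.
  have : 1%:A = d^-1 *: pullback g (reg a).
    by rewrite ga scalerA mulVf // a'0 reg0.
  move/(congr1 (pullback g^-1%g)); rewrite !linearZ /= pullbackK rmorph1 -(reg0 k S).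
  case: ha => Sa _ /(scale_reg_inj (am0 S) Sa (oner_neq0 _)) a0.
  by rewrite -a0 pairing0 in ai.
have le := amin _ ha' a'0.
have a0 : 0 < pairing a u' by rewrite ai.
set p := absz (pairing n u'); set q := absz (pairing a u').
have pE : pairing n u' = p by rewrite gez0_abs // ge0.
have qE : pairing a u' = q by rewrite gez0_abs // ge0.
have e : n *+ q = a *+ p.
  apply: (frame_eq F); rewrite !pairingMn; first by rewrite hn.2 ha.2 !mul0rn.
  by rewrite !mulrn_int -pE -qE mulrC.
have [[[Sn Sa] Sn'] Sa'] := (hn.1, ha.1, hn'.1, ha'.1).
have {}e : n' *+ q = a' *+ p.
  apply: (@scale_reg_inj (c ^+ q) (d ^+ p)); rewrite ?amMn ?expf_neq0 //.
  by rewrite !regMn // -!exprZn -gn -ga -!rmorphXn -!regMn // e.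
have := congr1 (fun m => pairing m u') e.
rewrite /= !pairingMn !mulrn_int -pE -qE => e'.
rewrite -(ler_pM2r a0) e' mulrC ler_wpM2r //; exact: ge0.
Qed.

Lemma facet_fixed g n : in_facet n ->
  exists2 c : k, c != 0 & pullback g (reg n) = c *: reg n.
Proof.
move=> hn; have [c [n' [c0 hn' gn]]] := facet_image g hn.
exists c => //; rewrite gn; congr (_ *: reg _).
have h1 := facet_image_ge hn hn' c0 gn.
have gn' : pullback g^-1%g (reg n') = c^-1 *: reg n.
  by rewrite -(scalerK c0 (reg n')) -gn linearZ /= pullbackK.
have := facet_image_ge hn' hn _ gn'; rewrite invr_eq0 => /(_ c0) h2.
apply: (frame_eq F); first by case: hn hn' => [_ ->] [_ ->].
by apply/eqP; rewrite eq_le h1 h2.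
Qed.

End FacetFixed.

Lemma mul_scale_cancel (k : fieldType) (B : comAlgType k) (c c' : k)
    (x y p q p' : B) : c != 0 -> p * p' = 1 ->
  x * (c *: p) = y * (c' *: q) -> x = (c' / c) *: (y * (q * p')).
Proof.
move=> c0 pp e.
have -> : x = c^-1 *: (x * (c *: p) * p').
  by rewrite -scalerAr -scalerAl scalerA mulVf // scale1r -mulrA pp mulr1.
by rewrite e -scalerAr -scalerAl scalerA mulrC mulrA.
Qed.

(** In the grading by [u] the power [f ^+ j] is homogeneous of degree [- j], so only the terms 1 and
    [f *+ i] of the expansion reach degrees 0 and -1. *)
Lemma mcoeff_exp1D (k : fieldType) (u : 'rV[int]_2) (f : laurent k 2) i :
  (forall b, b \in msupp f -> pairing b u = -1) ->
  ((1 + f) ^+ i)@_0 = 1 /\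
  forall b, pairing b u = -1 -> ((1 + f) ^+ i)@_b = i%:R * f@_b.
Proof.
move=> hf.
have hfX j b : b \in msupp (f ^+ j) -> pairing b u = - j%:Z.
  elim: j b => [|j IH] b.
    by rewrite expr0 -(chi0 k 2) => /msupp_chi->; rewrite pairing0.
  by rewrite exprS => /msuppM[x [y [/hf hx /IH hy ->]]]; rewrite pairingD hx hy; lia.
have fX0 j b : pairing b u <> - j%:Z -> (f ^+ j)@_b = 0.
  by move=> h; apply: mcoeff_outdom; apply/negP => /hfX.
have sumE b : ((1 + f) ^+ i)@_b = \sum_(j < i.+1) (f ^+ j)@_b *+ 'C(i, j).
  rewrite exprDn raddf_sum; apply: eq_bigr => j _.
  by rewrite /= expr1n mul1r mcoeffMn.
split=> [|b hb]; rewrite sumE.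
  rewrite big_ord_recl expr0 bin0 -(chi0 k 2) mcoeff_chi eqxx big1 ?addr0 // => j _.
  by rewrite fX0 ?mul0rn // pairing0 /= /bump; lia.
case: i {sumE} => [|i].
  by rewrite big_ord1 fX0 ?mul0rn ?mul0r // hb.
rewrite 2!big_ord_recl fX0 ?hb // mul0rn add0r expr1 bin1 mulr_natl.
by rewrite big1 ?addr0 // => j _; rewrite fX0 ?mul0rn // hb /= /bump; lia.
Qed.

(** * Leading terms and the shape of an automorphism *)

Section Structure.
Context (k : fieldType) (S : affine_monoid 2) (w w' u u' : 'rV[int]_2).
Context (F : frame S w w' u u').
Local Notation M := 'rV[int]_2.
Local Notation A := (monoid_algebra k S).
Local Notation L := (laurent k 2).
Local Notation in_facet := (in_facet S u).
Implicit Types (m n b : M) (g : aut A).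

Context (pres : forall g f,
  (forall m, m \in msupp (ma_val f) -> 0 < pairing m u') ->
  (forall m, m \in msupp (ma_val (pullback g f)) -> 0 < pairing m u')).
Context (a : M) (Sa : a \in S) (a1 : pairing a u = 1).
Context (decomp : forall m, m \in S -> eqv_facet S u m (a *+ `|pairing m u|%N)).

Definition image_val g m : L := ma_val (pullback g (reg m)).
(** The factor by which [g] multiplies [chi a], which turns out to be a nonzero scalar times 1 +
    f. *)
Definition shape g : L := image_val g a * chi (- a).

Lemma chiNK m : chi m * chi (- m) = 1 :> L.
Proof. by rewrite -chiD subrr chi0. Qed.

(** Apply [g] to the relation between [m] and a multiple of [a] given by [decomp]. The facet
    monomials are only rescaled and can be cancelled in the Laurent ring. *)
Lemma image_valE g m : m \in S -> exists2 c : k, c != 0 &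
  image_val g m = c *: (chi m * shape g ^+ `|pairing m u|%N).
Proof.
move=> Sm; have [n [n' [hn hn' e]]] := decomp Sm.
have [c c0 gn] := facet_fixed F pres g hn.
have [c' c0' gn'] := facet_fixed F pres g hn'.
exists (c' / c); first by rewrite mulf_neq0 ?invr_eq0.
set l := absz _ in e *.
have E0 : reg m * reg n = reg a ^+ l * reg n' :> A.
  by rewrite -(regMn _ l Sa) -(regD _ Sm hn.1) -(regD _ (amMn l Sa) hn'.1) e.
have {}E0 : pullback g (reg m) * pullback g (reg n) =
    pullback g (reg a) ^+ l * pullback g (reg n').
  by rewrite -rmorphXn -!rmorphM E0.
move: (congr1 (fun f => ma_val f) E0) => {E0}.
rewrite !ma_valM gn gn' !ma_valZ (reg_val k hn.1) (reg_val k hn'.1).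
rewrite (_ : ma_val (_ ^+ _) = image_val g a ^+ l); last first.
  exact: (rmorphXn (@ma_val k 2 S)).
rewrite -/(image_val g m) /shape exprMn -chiMn.
move: (image_val g m) (image_val g a) => x y {gn gn'} E.
have {}E : x = (c' / c) *: (y ^+ l * (chi n' * chi (- n))).
  exact: (mul_scale_cancel c0 (chiNK n) E).
rewrite E; congr (_ *: _); rewrite [RHS]mulrCA; congr (_ * _); rewrite -!chiD.
by congr chi; apply/eqP; rewrite subr_eq mulNrn addrAC e addrAC subrr add0r.
Qed.

Lemma msupp_image_val g m b : b \in msupp (image_val g m) -> b \in S.
Proof. exact: supp_in. Qed.

Lemma image_val_neq0 g m : m \in S -> image_val g m != 0.
Proof.
move=> Sm; apply/eqP => h.
have : reg m = 0 :> A.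
  rewrite -(pullbackK g (reg m)) (_ : pullback g (reg m) = 0) ?rmorph0 //.
  exact: ma_val_inj.
move/(congr1 (fun f => ma_val f)); rewrite reg_val // => /eqP.
exact/negP/chi_neq0.
Qed.

Section Lead.
Context (v : M) (v_u' : v = u' \/ v = - u').
Local Notation P := (lex_pos u v).
Let P_cone : positive_cone P := lex_pos_cone F v_u'.

Lemma lead_image_val g d m : is_lead P (image_val g a) (a + d) -> m \in S ->
  is_lead P (image_val g m) (m + d *+ `|pairing m u|%N).
Proof.
move=> hd Sm; have [c c0 ->] := image_valE g Sm; apply: leadZ => //.
apply: lead_mul => //; first exact: lead_chi.
apply: lead_exp => //; rewrite (_ : d = a + d - a); last by rewrite addrAC subrr add0r.
by apply: lead_mul => //; apply: lead_chi.
Qed.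

(** If the degree dropped, then [a + d] and every smaller exponent would lie on the facet, since
    [pairing a u = 1]. The inverse of [g] rescales facet monomials, so [chi a] would be supported on
    the facet. *)
Lemma lead_degree_gt0 g d : is_lead P (image_val g a) (a + d) -> 0 <= pairing d u.
Proof.
move=> hd; have Sad : a + d \in S.
  by apply: (@msupp_image_val g a); rewrite -mcoeff_neq0; case: hd.
have := frame_ge0 F Sad; rewrite pairingD a1 => ge0.
rewrite leNgt; apply/negP => d0.
have facetG b : b \in msupp (image_val g a) -> in_facet b.
  move=> hb; have Sb := msupp_image_val hb; split=> //.
  have := frame_ge0 F Sb; case: (hd.2 _ hb) => [->|].
    by rewrite pairingD; lia.
  by rewrite /lex_pos pairingB pairingD; lia.
suff : (ma_val (reg a : A))@_a = 0.
  by rewrite reg_val // mcoeff_chi eqxx => /eqP; rewrite oner_eq0.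
rewrite -(pullbackK g (reg a)) lrmorph_lext mcoeff_lext big1_seq //= => b hb.
have hbf := facetG _ hb.
have [c _ e] := facet_fixed F pres (g^-1)%g hbf; rewrite pullbackV in e.
rewrite e mcoeff_scale_reg; last by case: hbf.
case: eqP => [ba|_]; last by rewrite !mulr0.
by case: hbf => _; rewrite ba a1.
Qed.

(** Nonnegativity of [pairing d u] makes the map sending [m] to [m + d *+ pairing m u] strictly
    increasing on the relevant exponents: it is a translation on each level of [u] and widens the
    gaps between levels. *)
Lemma lead_comp g d (f : L) m0 : (forall m, m \in msupp f -> m \in S) ->
  is_lead P (image_val g a) (a + d) -> is_lead P f m0 ->
  is_lead P (lext (image_val g) f) (m0 + d *+ `|pairing m0 u|%N) /\
  (lext (image_val g) f)@_(m0 + d *+ `|pairing m0 u|%N) =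
    f@_m0 * (image_val g m0)@_(m0 + d *+ `|pairing m0 u|%N).
Proof.
move=> Sf hd hf; have d0 := lead_degree_gt0 hd.
apply: (lead_lext P_cone (La := fun m => m + d *+ `|pairing m u|%N) _ _ hf).
  by move=> m /Sf Sm; apply: lead_image_val.
have Sm0 : m0 \in S by apply: Sf; rewrite -mcoeff_neq0; case: hf.
move=> m /Sf Sm; have ge0 := frame_ge0 F Sm; have ge00 := frame_ge0 F Sm0.
case: (eqVneq (pairing m u) (pairing m0 u)) => e.
  by rewrite e opprD addrACA subrr addr0.
rewrite /lex_pos !pairingB !pairingD !pairingMn.
rewrite !mulrn_int !gez0_abs // => H; apply/orP; left.
have lt : pairing m u < pairing m0 u by lia.
nia.
Qed.

Lemma image_valM g h m :
  image_val (g * h)%g m = lext (image_val h) (image_val g m).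
Proof.
by rewrite /image_val pullbackM (lrmorph_lext (pullback h) (pullback g (reg m))).
Qed.

Lemma image_val1 m : m \in S -> image_val 1%g m = chi m.
Proof. by move=> Sm; rewrite /image_val pullback1 reg_val. Qed.

(** Comparing leading exponents in the composite of [g] with its inverse gives (1 + l(d))(1 + l(d'))
    = 1 for l the pairing with [u]. Both factors being at least 1, l(d) = l(d') = 0, and then the
    shifts cancel. *)
Lemma lead_shift_inv g d d' : is_lead P (image_val g a) (a + d) ->
  is_lead P (image_val g^-1%g a) (a + d') -> pairing d u = 0 /\ d' = - d.
Proof.
move=> hd hd'.
have [] := @lead_comp g d (image_val g^-1%g a) (a + d') _ hd hd'.
  exact: msupp_image_val.
rewrite -image_valM mulVg image_val1 // => /(lead_uniq P_cone (lead_chi k P a)) e _.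
have h := lead_degree_gt0 hd; have h' := lead_degree_gt0 hd'.
have := congr1 (fun m => pairing m u) e.
rewrite /= !pairingD pairingMn mulrn_int a1 gez0_abs; last by lia.
move=> e'; have d0 : pairing d u = 0 by nia.
split=> //; have d'0 : pairing d' u = 0 by rewrite d0 mul0r in e'; lia.
move: e; rewrite pairingD a1 d'0 addr0 mulr1n -addrA => /eqP.
by rewrite -subr_eq0 opprD addrA subrr sub0r oppr_eq0 addr_eq0 => /eqP.
Qed.

(** A shift along the facet direction can be repeated: each [a + d *+ j] is an exponent of a regular
    function, so it lies in [S], where pairings with [u'] are bounded below. *)
Lemma lead_shift_ge0 g d : is_lead P (image_val g a) (a + d) ->
  pairing d u = 0 -> 0 <= pairing d u'.
Proof.
move=> hd d0; have iter j : a + d *+ j \in S.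
  elim: j => [|j IH]; first by rewrite addr0.
  apply: (@msupp_image_val g (a + d *+ j)); rewrite -mcoeff_neq0.
  have := lead_image_val hd IH; rewrite pairingD pairingMn d0 mul0rn addr0 a1.
  by rewrite [d *+ j.+1]mulrSr addrA => -[].
(* This many steps would make the pairing with [u'] negative if [d] paired negatively. *)
have := frame_ge0' F (iter (absz (pairing a u')).+1).
rewrite pairingD pairingMn -mulr_natr natz; have := frame_ge0' F Sa.
nia.
Qed.

(** The shift for the inverse is [- d], so both [d] and [- d] pair nonnegatively with [u'], and [d]
    is zero. *)
Lemma lead_image_val_a g : is_lead P (image_val g a) a.
Proof.
have ex h : exists d, is_lead P (image_val h a) (a + d).
  have [b hb] := lead_exists P_cone (image_val_neq0 h Sa).
  by exists (b - a); rewrite addrC subrK.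
have [d hd] := ex g; have [d' hd'] := ex (g^-1)%g.
have [d0 d'E] := lead_shift_inv hd hd'.
have d'0 : pairing d' u = 0 by rewrite d'E pairingN d0 oppr0.
have h := lead_shift_ge0 hd d0; have := lead_shift_ge0 hd' d'0.
rewrite d'E pairingN => h'.
have dz : d = 0 by apply: (frame_inj F) => //; lia.
by rewrite dz addr0 in hd.
Qed.

Lemma lead_image_val_m g m : m \in S -> is_lead P (image_val g m) m.
Proof.
move=> Sm; have := @lead_image_val g 0 m; rewrite addr0 => /(_ (lead_image_val_a g) Sm).
by rewrite mul0rn addr0.
Qed.

(** The torus part of [g], evaluated at [m]. As a leading coefficient it is multiplicative in [g]
    and in [m], which provides the projection onto the torus. *)
Definition weight g m : k := (image_val g m)@_m.

Lemma weight_neq0 g m : m \in S -> weight g m != 0.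
Proof. by move=> Sm; case: (lead_image_val_m g Sm). Qed.

Lemma weightM g h m : m \in S -> weight (g * h)%g m = weight g m * weight h m.
Proof.
move=> Sm; rewrite /weight image_valM.
have [||_] := @lead_comp h 0 (image_val g m) m (@msupp_image_val g m).
- by rewrite addr0; apply: lead_image_val_a.
- exact: lead_image_val_m.
by rewrite mul0rn addr0.
Qed.

End Lead.

Lemma weight1 m : m \in S -> weight 1%g m = 1.
Proof. by move=> Sm; rewrite /weight image_val1 // mcoeff_chi eqxx. Qed.

Lemma weightD g m n : m \in S -> n \in S -> weight g (m + n) = weight g m * weight g n.
Proof.
move=> Sm Sn; rewrite /weight.
have -> : image_val g (m + n) = image_val g m * image_val g n.
  by rewrite /image_val regD // rmorphM ma_valM.
have P_cone := lex_pos_cone F (or_introl erefl).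
have lead x := lead_image_val_m (or_introl (erefl u')) g (m := x).
exact: (mcoeffM_lead P_cone (lead m Sm) (lead n Sn)).
Qed.

(* [chi a] leads [g (chi a)] for both lexicographic orders [(u, u')] and
   [(u, - u')], so all other terms of [g (chi a)] lie strictly below it in [u]. *)
Lemma aut_structure g : exists f : L,
  (forall b, b \in msupp f -> pairing b u = -1) /\
  forall m, m \in S ->
    image_val g m = weight g m *: (chi m * (1 + f) ^+ `|pairing m u|%N).
Proof.
have lead1 : is_lead (lex_pos u u') (image_val g a) a.
  by apply: lead_image_val_a; left.
have lead2 : is_lead (lex_pos u (- u')) (image_val g a) a.
  by apply: lead_image_val_a; right.
pose t := weight g a; have t0 : t != 0 by apply: (weight_neq0 (or_introl erefl)).
pose f := t^-1 *: shape g - 1.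
have shapeE b : (shape g)@_b = (image_val g a)@_(a + b).
  rewrite /shape mulrC -[RHS](mcoeff_chiM (- a) _ (a + b)).
  by rewrite addKr.
have hf b : b \in msupp f -> pairing b u = -1.
  rewrite -mcoeff_neq0 /f mcoeffB mcoeffZ shapeE -(chi0 k 2) mcoeff_chi => h.
  have b0 : b != 0.
    by apply: contraNneq h => ->; rewrite addr0 eqxx mulVf ?subrr.
  move: h; rewrite [0 == b]eq_sym (negPf b0) subr0 mulf_eq0 invr_eq0 (negPf t0) /=.
  rewrite mcoeff_neq0 => h; have := frame_ge0 F (msupp_image_val h).
  have neg : a + b <> a.
    by move=> /(canRL (addKr _)); rewrite addNr; apply/eqP.
  case: (lead1.2 _ h) => // h1; case: (lead2.2 _ h) => // h2.
  move: h1 h2; rewrite /lex_pos !pairing_oppr !pairingB !pairingD a1; lia.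
have shape_f : shape g = t *: (1 + f).
  by rewrite /f addrC subrK scalerA mulfV // scale1r.
exists f; split; first exact: hf.
move=> m Sm; have [c c0 e] := image_valE g Sm.
(* The unknown scalar [c] is eliminated by reading the coefficient at [m], where the power of
   [1 + f] contributes 1. *)
suff E : weight g m = c * t ^+ `|pairing m u|%N.
  rewrite e shape_f exprZn -scalerAr scalerA E.
  reflexivity.
rewrite /weight e shape_f exprZn -scalerAr !mcoeffZ -{2}[m]addr0 mcoeff_chiM.
by rewrite (mcoeff_exp1D _ hf).1 mulr1.
Qed.

End Structure.

(** * The ray of [sigma S] spanned by [u] *)

Section Ray.
Context (S : affine_monoid 2) (w w' u u' : 'rV[int]_2).
Context (F : frame S w w' u u').
Local Notation MQ := (map_mx (intr : int -> rat)).

Lemma pairing_rat (m v : 'rV[int]_2) : pairing (MQ m) (MQ v) = (pairing m v)%:~R.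
Proof. by rewrite !pairing2E !mxE rmorphD !rmorphM. Qed.

Lemma pairing_scaler (m v : 'rV[rat]_2) c : pairing m (c *: v) = c * pairing m v.
Proof. by rewrite !pairing2E !mxE; ring. Qed.

(** The supporting functional is [w]. A point of the face is determined by its pairing with [w'],
    because [w] and [w'] are independent. *)
Lemma frame_ray : exists2 rho, is_ray (sigma S) rho & primitive_generator rho u.
Proof.
have u0 : u != 0.
  have [p p1] := frame_prim F; apply/eqP => u0; move: p1.
  by rewrite u0 pairing2E !mxE !mulr0.
exists [set c *: MQ u | c in [set c : rat | 0 <= c]]; last first.
  split; first by exists 1; rewrite ?scale1r //=.
  move=> d x ux; have [p p1] := frame_prim F.
  have : d * pairing p x = 1.
    by rewrite -p1 ux !pairing2E !mxE; ring.
  by move/(congr1 absz); rewrite abszM => /eqP; rewrite muln_eq1 => /andP[/eqP h _]; lia.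
split; last first.
  exists (MQ u) => //; apply: contraNneq u0 => e; apply/eqP/row2P.
    by apply/eqP; rewrite mxE; move/rowP/(_ 0): e; rewrite !mxE => /eqP; rewrite intr_eq0.
  by apply/eqP; rewrite mxE; move/rowP/(_ 1): e; rewrite !mxE => /eqP; rewrite intr_eq0.
exists (MQ w); split=> [v sv|].
  exact: sv (frame_S F).
rewrite eqEsubset; split=> [v /= [c c0 <-]|v /= [sv wv]].
  split; last by rewrite pairing_scaler pairing_rat (frame_w0 F) mulr0.
  move=> m Sm; rewrite pairing_scaler pairing_rat mulr_ge0 // ler0z.
  exact: (frame_ge0 F).
pose l' : rat := (pairing w' u)%:~R.
have l'0 : 0 < l' by rewrite ltr0z (frame_gt0' F).
pose c := pairing (MQ w') v / l'.
exists c; first by rewrite /= divr_ge0 ?(ltW l'0) // sv // (frame_S' F).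
have det : (w 0 0 * w' 0 1 - w 0 1 * w' 0 0)%:~R != 0 :> rat.
  rewrite intr_eq0; apply/eqP => D0.
  have : (w 0 0 * w' 0 1 - w 0 1 * w' 0 0) * (u 0 0 * u' 0 1 - u 0 1 * u' 0 0) =
    pairing w u * pairing w' u' - pairing w u' * pairing w' u.
    by rewrite !pairing2E; ring.
  rewrite D0 mul0r (frame_w0 F) mul0r sub0r => /esym/eqP; rewrite oppr_eq0 mulf_eq0.
  by rewrite !gt_eqF ?(frame_gt0 F) ?(frame_gt0' F).
pose d := c *: MQ u - v.
have e1 : pairing (MQ w) d = 0.
  have -> : pairing (MQ w) d = pairing (MQ w) (c *: MQ u) - pairing (MQ w) v.
    by rewrite !pairing2E !mxE; ring.
  by rewrite pairing_scaler pairing_rat (frame_w0 F) wv mulr0 subrr.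
have e2 : pairing (MQ w') d = 0.
  have -> : pairing (MQ w') d = pairing (MQ w') (c *: MQ u) - pairing (MQ w') v.
    by rewrite !pairing2E !mxE; ring.
  by rewrite pairing_scaler pairing_rat /c mulfVK ?subrr // gt_eqF.
apply/eqP; rewrite -subr_eq0 -/d; apply/eqP.
move: (d) e1 e2 det => {}d; rewrite !pairing2E !mxE rmorphB !rmorphM /=.
set x := d 0 0; set y := d 0 1.
set p : rat := (w 0 0)%:~R; set q : rat := (w 0 1)%:~R.
set p' : rat := (w' 0 0)%:~R; set q' : rat := (w' 0 1)%:~R => e1 e2 det.
have x0 : x * (p * q' - q * p') = 0.
  rewrite (_ : x * _ = q' * (p * x + q * y) - q * (p' * x + q' * y)); last by ring.
  by rewrite e1 e2 !mulr0 subrr.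
have y0 : y * (p * q' - q * p') = 0.
  rewrite (_ : y * _ = p * (p' * x + q' * y) - p' * (p * x + q * y)); last by ring.
  by rewrite e1 e2 !mulr0 subrr.
by apply: row2P; rewrite [RHS]mxE; apply: (mulIf det); rewrite mul0r.
Qed.

End Ray.

Lemma binomial_term (k : fieldType) (B : comAlgType k) (j : nat) (c : k) (x y z : B) :
  (j%:R * c) *: (x * y * z) = x * ((z * (c *: y)) *+ j).
Proof. by rewrite mulr_natl -scalerMnl -scalerAr mulrnAr -scalerAr -mulrA [y * z]mulrC. Qed.

(** * Root automorphisms attached to [u] *)

Section RootAut.
Context (k : fieldType) (S : affine_monoid 2) (w w' u u' : 'rV[int]_2).
Context (F : frame S w w' u u').
Local Notation M := 'rV[int]_2.
Local Notation A := (monoid_algebra k S).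
Local Notation L := (laurent k 2).
Implicit Types (m n b : M) (f : L).

(** Normal form of a unipotent automorphism. A root automorphism has [f = alpha *: chi e], and
    composition adds the functions [f], so inverses and commutation become visible. *)
Definition acts_by (phi : A -> A) f : Prop := forall m, m \in S ->
  ma_val (phi (reg m)) = chi m * (1 + f) ^+ `|pairing m u|%N.

Section OneRoot.
Context (e : M) (eu : pairing e u = -1).
Context (eS : forall m, m \in S -> 0 < pairing m u -> m + e \in S).

Definition root_image (alpha : k) m : A :=
  \sum_(i < (`|pairing m u|%N).+1)
    ('C(`|pairing m u|%N, i)%:R * alpha ^+ i) *: reg (m + e *+ i).

(** Each addition of [e] lowers the pairing with [u] by one, so the root condition applies until
    that pairing reaches 0. *)
Lemma root_string m i : m \in S -> (i <= `|pairing m u|)%N ->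
  m + e *+ i \in S /\ pairing (m + e *+ i) u = pairing m u - i%:Z.
Proof.
move=> Sm; have m0 := frame_ge0 F Sm.
have E j : pairing (m + e *+ j) u = pairing m u - j%:Z.
  by rewrite pairingD pairingMn eu -mulr_natr natz mulN1r.
elim: i => [|i IH] hi; first by rewrite addr0 subr0.
split; last exact: E.
have [Si ei] := IH (ltnW hi); rewrite mulrSr addrA; apply: eS => //.
by rewrite ei; lia.
Qed.

(** After [i] additions of [e] the exponent of [1 + f] is the original pairing minus [i], so the sum
    is the binomial expansion for [1 + f] and [alpha *: chi e]. *)
Lemma acts_by_root_image (phi : {lrmorphism A -> A}) f alpha m :
  acts_by phi f -> m \in S -> ma_val (phi (root_image alpha m)) =
    chi m * (1 + f + alpha *: chi e) ^+ `|pairing m u|%N.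
Proof.
move=> hphi Sm; rewrite /root_image raddf_sum ma_val_sum exprDn mulr_sumr.
apply: eq_bigr => i _; have [Si ei] := root_string Sm (ltn_ord i : (i <= _)%N).
rewrite /= linearZ ma_valZ (hphi _ Si) ei exprZn -chiMn.
have -> : absz (pairing m u - i%:Z) = (absz (pairing m u) - i)%N.
  by have := frame_ge0 F Sm; have := ltn_ord i; lia.
by rewrite chiD binomial_term.
Qed.

Lemma acts_by_id : acts_by id 0.
Proof. by move=> m Sm; rewrite reg_val // addr0 expr1n mulr1. Qed.

Lemma root_image_val alpha m : m \in S ->
  ma_val (root_image alpha m) = chi m * (1 + alpha *: chi e) ^+ `|pairing m u|%N.
Proof.
move=> Sm; have := @acts_by_root_image idfun 0 alpha m acts_by_id Sm.
by rewrite addr0.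
Qed.

Lemma root_aut_exists alpha : exists g : aut A,
  forall m, m \in S -> pullback g (reg m) = root_image alpha m.
Proof.
have mul al : root_image al 0 = 1 /\ forall a b, a \in S -> b \in S ->
    root_image al (a + b) = root_image al a * root_image al b.
  split=> [|a b Sa Sb]; apply: ma_val_inj.
    by rewrite root_image_val ?am0 // pairing0 expr0 mulr1 chi0.
  rewrite ma_valM !root_image_val ?amD // pairingD chiD.
  have -> : absz (pairing a u + pairing b u) = (absz (pairing a u) + absz (pairing b u))%N.
    by have := frame_ge0 F Sa; have := frame_ge0 F Sb; lia.
  by rewrite exprD mulrACA.
have [G0 GD] := mul alpha; have [G0' GD'] := mul (- alpha).
have inv al (phi : {lrmorphism A -> A}) :
    (forall m, m \in S -> phi (reg m) = root_image al m) ->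
    forall m, m \in S -> phi (root_image (- al) m) = reg m.
  move=> hphi m Sm; apply: ma_val_inj.
  rewrite (@acts_by_root_image _ (al *: chi e)) //.
    by rewrite scaleNr addrK expr1n mulr1 reg_val.
  by move=> m' Sm'; rewrite hphi // root_image_val.
apply: (aut_lift G0 G0' GD GD') => phi hphi m Sm; first exact: inv hphi m Sm.
by rewrite -{1}[alpha]opprK; apply: inv Sm.
Qed.

End OneRoot.
End RootAut.

Section Generated.
Context (G : groupType).
Implicit Types (H B : set G).

Lemma generated_subgroup B : is_subgroup (generated B).
Proof.
split=> [H [[]]|x y hx hy H hH] //.
by case: (hH) => -[_ HV] _; apply: HV; [apply: hx | apply: hy].
Qed.

Lemma mem_generated B x : B x -> generated B x.
Proof. by move=> Bx H [_]; apply. Qed.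

Lemma generated_min B H : is_subgroup H -> B `<=` H -> generated B `<=` H.
Proof. by move=> sH BH; apply: smallest_sub. Qed.

Lemma is_subgroupV H x : is_subgroup H -> H x -> H x^-1%g.
Proof. by move=> [H1 HV] Hx; rewrite -[x^-1%g]mul1g; apply: HV. Qed.

Lemma is_subgroupM H x y : is_subgroup H -> H x -> H y -> H (x * y)%g.
Proof.
by move=> sH Hx Hy; rewrite -[y]invgK; apply: sH.2 => //; apply: is_subgroupV.
Qed.

End Generated.

(** * The torus as the group of characters of the lattice *)

Section Torus.
Context (k : fieldType) (n : nat) (S : affine_monoid n).
Local Notation M := 'rV[int]_n.
Local Notation A := (monoid_algebra k S).
Implicit Types (s : M -> k) (g : aut A).

Definition is_character s : Prop := s 0 = 1 /\ forall a b, s (a + b) = s a * s b.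

Lemma characterN s m : is_character s -> s m != 0 /\ s (- m) = (s m)^-1.
Proof.
move=> [s0 sD]; have e : s m * s (- m) = 1 by rewrite -sD subrr.
have sm : s m != 0.
  by apply: contra_eq_neq e => ->; rewrite mul0r eq_sym oner_neq0.
by split=> //; apply: (mulfI sm); rewrite e mulfV.
Qed.

Lemma characterMn s m i : is_character s -> s (m *+ i) = s m ^+ i.
Proof.
by move=> [s0 sD]; elim: i => [|i IH]; rewrite ?s0 // mulrS sD IH exprS.
Qed.

Lemma character_prod s m : is_character s ->
  s m = \prod_(i < n) s (delta_mx 0 i) ^ m 0 i.
Proof.
move=> hs; have [s0 sD] := hs; rewrite {1}[m]row_sum_delta (big_morph s sD s0).
apply: eq_bigr => i _; rewrite -[X in X *: _]intz scaler_int.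
case: (m 0 i) => j; first exact: characterMn.
by rewrite NegzE mulrNz (characterN _ hs).2 characterMn.
Qed.

Lemma torusP g : torus k S g <-> exists2 s, is_character s &
  forall m, m \in S -> pullback g (reg m) = s m *: reg m.
Proof.
split=> [[t [t0 gt]]|[s hs gs]].
  exists (fun m => \prod_(i < n) t 0 i ^ m 0 i).
    split; first by rewrite big1 // => i _; rewrite mxE.
    move=> a b; rewrite -big_split; apply: eq_bigr => i _.
    by rewrite mxE expfzDr.
  move=> m Sm; apply: ma_val_inj; rewrite -reg_mono (gt _ Sm) reg_mono.
  by rewrite ma_valZ reg_val.
exists (\row_i s (delta_mx 0 i)); split=> [i|m Sm].
  by rewrite mxE; case: (characterN (delta_mx 0 i) hs).
have e : s m = \prod_(i < n) (\row_i s (delta_mx 0 i) : 'rV[k]_n) 0 i ^ m 0 i.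
  by rewrite (character_prod _ hs); apply: eq_bigr => i _; rewrite mxE.
by rewrite reg_mono (gs _ Sm) ma_valZ (reg_val k Sm) e.
Qed.

Lemma torus_inv g s m : is_character s ->
  (forall m, m \in S -> pullback g (reg m) = s m *: reg m) -> m \in S ->
  pullback_inv g (reg m) = (s m)^-1 *: reg m.
Proof.
move=> hs gs Sm; have [sm _] := characterN m hs.
apply: (can_inj (pullbackK g)); rewrite pullback_invK linearZ /=.
by rewrite (gs _ Sm) scalerA mulVf // scale1r.
Qed.

Lemma torus_subgroup : is_subgroup (torus k S).
Proof.
split.
  apply/torusP; exists (fun=> 1); first by split=> // a b; rewrite mulr1.
  by move=> m Sm; rewrite pullback1 scale1r.
move=> g h /torusP[s hs gs] /torusP[t ht ht']; apply/torusP.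
exists (fun m => s m / t m).
  split; first by rewrite hs.1 ht.1 divr1.
  by move=> a b; rewrite hs.2 ht.2 invfM mulrACA.
move=> m Sm; rewrite pullbackM (gs _ Sm) linearZ /=.
by rewrite (torus_inv ht ht' Sm) scalerA.
Qed.

(** Every lattice element is a difference of elements of [S], and the quotient of the values of [t]
    does not depend on the chosen difference. *)
Lemma extend_character (t : M -> k) : t 0 = 1 -> (forall m, m \in S -> t m != 0) ->
  (forall a b, a \in S -> b \in S -> t (a + b) = t a * t b) ->
  exists2 s, is_character s & forall m, m \in S -> s m = t m.
Proof.
move=> t1 t0 tD.
have ex m : exists p : M * M, [/\ p.1 \in S, p.2 \in S & m = p.1 - p.2].
  by have [a [b h]] := am_diff S m; exists (a, b).
have [p hp] := choice ex.
have wd m a b : a \in S -> b \in S -> m = a - b -> t (p m).1 / t (p m).2 = t a / t b.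
  move=> Sa Sb e; have [S1 S2 e'] := hp m.
  apply/eqP; rewrite eqr_div ?t0 // -!tD //; apply/eqP; congr t.
  have -> : (p m).1 = m + (p m).2 by apply/eqP; rewrite -subr_eq -e'.
  by rewrite addrAC [in m + b]e subrK.
exists (fun m => t (p m).1 / t (p m).2); last first.
  by move=> m Sm; rewrite (wd m m 0) ?am0 ?subr0 // t1 divr1.
split; first by rewrite (wd 0 0 0) ?am0 ?subr0 // t1 divr1.
move=> a b; have [S1 S2 e] := hp a; have [S1' S2' e'] := hp b.
rewrite (wd (a + b) ((p a).1 + (p b).1) ((p a).2 + (p b).2)) ?amD //.
  by rewrite !tD // invfM mulrACA.
by rewrite {1}e {1}e' opprD addrACA.
Qed.

End Torus.

(** * Root subgroups *)

Section RootSubgroup.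
Context (k : fieldType).
Context (S : affine_monoid 2) (w w' u u' : 'rV[int]_2).
Context (F : frame S w w' u u').
Local Notation M := 'rV[int]_2.
Local Notation A := (monoid_algebra k S).
Implicit Types (m n e b : M) (g h : aut A).

Context (a : M) (Sa : a \in S) (a1 : pairing a u = 1).

(** Demazure roots at the ray of [u]; that [u] does generate a ray of [sigma S] is supplied by
    [frame_ray]. *)
Definition facet_root e : Prop :=
  pairing e u = -1 /\ forall m, m \in S -> 0 < pairing m u -> m + e \in S.

Definition is_root_map e alpha g : Prop :=
  forall m, m \in S -> pullback g (reg m) = root_image S u e alpha m.

Lemma facet_root_demazure e : facet_root e -> demazure_root S u e.
Proof. by move=> [eu eS]; split=> //; apply: frame_ray F. Qed.

Lemma root_map_is_root_aut e alpha g : facet_root e -> is_root_map e alpha g ->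
  is_root_aut u e alpha g.
Proof.
move=> [eu eS] ge m Sm l; rewrite reg_mono (ge _ Sm) /root_image ma_val_sum.
apply: eq_bigr => i _; rewrite ma_valZ (reg_val k) //.
exact: (root_string F eu eS Sm (ltn_ord i : (i <= _)%N)).1.
Qed.

Lemma acts_by_eq g h f : acts_by u (pullback g : A -> A) f ->
  acts_by u (pullback h : A -> A) f -> g = h.
Proof.
by move=> hg hh; apply: aut_eq => m Sm; apply: ma_val_inj; rewrite hg ?hh.
Qed.

Lemma acts_by_root_map e alpha g : facet_root e -> is_root_map e alpha g ->
  acts_by u (pullback g : A -> A) (alpha *: chi e).
Proof.
by move=> [eu eS] ge m Sm; rewrite (ge _ Sm) (root_image_val F eu eS).
Qed.

Lemma acts_by_mul e alpha g h f : facet_root e -> is_root_map e alpha h ->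
  acts_by u (pullback g : A -> A) f ->
  acts_by u (pullback (h * g)%g : A -> A) (f + alpha *: chi e).
Proof.
move=> [eu eS] he hg m Sm; rewrite pullbackM (he _ Sm).
by rewrite (acts_by_root_image F eu eS _ hg Sm) addrA.
Qed.

Lemma root_map_exists e alpha : facet_root e -> exists g, is_root_map e alpha g.
Proof. by move=> [eu eS]; apply: (root_aut_exists F eu eS). Qed.

Lemma root_map_coaction e : exists P : A -> {poly A}, forall f alpha g,
  is_root_map e alpha g -> pullback g f = (P f).[alpha%:A].
Proof.
pose Q m : {poly A} := \sum_(i < (`|pairing m u|%N).+1)
    ('C(`|pairing m u|%N, i)%:R *: reg (m + e *+ i) : A)%:P * 'X^i.
exists (fun f => \sum_(m <- msupp (ma_val f)) ((ma_val f)@_m *: (1 : A))%:P * Q m).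
move=> f alpha g ge; rewrite (lrmorph_expand (pullback g) f) horner_sum.
apply: eq_big_seq => m /supp_in Sm; rewrite hornerM hornerC (ge _ Sm).
rewrite mulr_algl; congr (_ *: _); rewrite /Q horner_sum /root_image.
apply: eq_bigr => i _; rewrite hornerM hornerC hornerXn.
have algX j : (alpha%:A : A) ^+ j = (alpha ^+ j)%:A.
  elim: j => [|j IH]; first by rewrite !expr0 scale1r.
  by rewrite !exprS IH mulr_algl scalerA.
by rewrite algX mulr_algr scalerA mulrC.
Qed.

(** The parameter is recovered as the coefficient of [chi (a + e)] in the image of [chi a], because
    [pairing a u = 1]. Conjugation by a torus element with character [s] divides the parameter by
    [s e]. *)
Lemma root_subgroup e : facet_root e -> exists H, is_root_subgroup (S := S) H /\
  forall alpha g, is_root_map e alpha g -> H g.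
Proof.
move=> he; have [eu eS] := he.
have [phi hphi] := choice (fun al => root_map_exists al he).
have uniq al g : is_root_map e al g -> g = phi al.
  move=> ge; apply: acts_by_eq (acts_by_root_map he ge) _.
  exact: acts_by_root_map.
exists (range phi); split; last first.
  by move=> al g /uniq ->; exists al.
split.
  have [P hP] := root_map_coaction e.
  exists phi; split=> // [al be|al be|f].
  - apply: acts_by_eq (acts_by_root_map he (hphi _)) _; rewrite scalerDl addrC.
    by apply: acts_by_mul => //; apply: acts_by_root_map.
  - move=> eq; have coef c : (ma_val (pullback (phi c) (reg a)))@_(a + e) = c.
      rewrite (acts_by_root_map he (hphi c) Sa) a1 expr1 mcoeff_chiM mcoeffD.
      rewrite mcoeffZ mcoeff_chi eqxx mulr1 -(chi0 k 2) mcoeff_chi.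
      by case: eqP => [e0|_]; [rewrite -e0 pairing0 in eu | rewrite add0r].
    by rewrite -[al]coef -[RHS]coef eq.
  - by exists (P f) => al; apply: hP.
move=> t h /torusP[s hs ts] [al _ <-].
have [se _] := characterN e hs.
suff /uniq-> : is_root_map e (al / s e) (t * phi al * t^-1)%g by exists (al / s e).
move=> m Sm; rewrite !pullbackM pullbackV (ts _ Sm) !linearZ /= (hphi _ _ Sm).
rewrite /root_image linear_sum scaler_sumr; apply: eq_bigr => i _.
have [Si _] := root_string F eu eS Sm (ltn_ord i : (i <= _)%N).
rewrite linearZ /= (torus_inv hs ts Si) !scalerA.
apply: (congr1 (fun c => c *: reg (m + e *+ i))).
rewrite hs.2 (characterMn _ _ hs) exprMn exprVn; have [sm _] := characterN m hs.
by field; rewrite sm expf_neq0.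
Qed.

End RootSubgroup.

(** * The semidirect decomposition *)

Section AutomorphismGroup.
Context (k : fieldType) (char0 : [pchar k] =i pred0).
Context (S : affine_monoid 2) (w w' u u' : 'rV[int]_2).
Context (F : frame S w w' u u').
Local Notation M := 'rV[int]_2.
Local Notation A := (monoid_algebra k S).
Local Notation L := (laurent k 2).
Implicit Types (m n e b : M) (g h : aut A).

Context (pres : forall g f,
  (forall m, m \in msupp (ma_val f) -> 0 < pairing m u') ->
  (forall m, m \in msupp (ma_val (pullback g f)) -> 0 < pairing m u')).
Context (a : M) (Sa : a \in S) (a1 : pairing a u = 1).
Context (decomp : forall m, m \in S -> eqv_facet S u m (a *+ `|pairing m u|%N)).

Let structure := aut_structure F pres Sa a1 decomp.
Let weight_nz g m : m \in S -> weight g m != 0 :=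
  weight_neq0 F pres Sa a1 decomp (or_introl erefl) g (m := m).
Let weight_mul g h m : m \in S -> weight (g * h)%g m = weight g m * weight h m :=
  weightM F pres Sa a1 decomp (or_introl erefl) g h (m := m).
Let weight_add g m n : m \in S -> n \in S ->
    weight g (m + n) = weight g m * weight g n :=
  weightD F pres Sa a1 decomp g (m := m) (n := n).

Definition unipotent : set (aut A) := [set g | forall m, m \in S -> weight g m = 1].
Definition facet_root_maps : set (aut A) :=
  [set g | exists e alpha, facet_root S u e /\ is_root_map u e alpha g].

Lemma weightV g m : m \in S -> weight g^-1%g m = (weight g m)^-1.
Proof.
move=> Sm; apply: (mulfI (weight_nz g Sm)).
by rewrite -weight_mul // mulgV weight1 // mulfV // weight_nz.
Qed.

Lemma unipotent_subgroup : is_subgroup unipotent.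
Proof.
split=> [m Sm|g h hg hh m Sm]; first exact: weight1.
by rewrite weight_mul // weightV // hg // hh // divr1.
Qed.

Lemma unipotent_acts_by g : unipotent g -> exists f : L,
  acts_by u (pullback g : A -> A) f /\ forall e, e \in msupp f -> facet_root S u e.
Proof.
move=> hg; have [f [hf fE]] := structure g; exists f; split=> [m Sm|e he].
  by have := fE _ Sm; rewrite hg // scale1r.
split=> [|m Sm m0]; first exact: hf.
(* The coefficient at [m + e] is a nonzero weight times [pairing m u] times [f@_e]. It is nonzero in
   characteristic zero, so [m + e] occurs in a regular function. *)
apply: (@msupp_image_val k S g m); rewrite -mcoeff_neq0 fE // mcoeffZ mcoeff_chiM.
rewrite ((mcoeff_exp1D _ hf).2 _ (hf _ he)).
apply: mulf_neq0; first exact: weight_nz.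
by rewrite mulf_neq0 ?mcoeff_neq0 // ((pcharf0P k).1 char0) absz_eq0 gt_eqF.
Qed.

(** A root map with parameter [- c e] removes the term at [e] from [f], so the list of exponents
    shrinks until only the identity is left. *)
Lemma unipotent_generated : unipotent `<=` generated facet_root_maps.
Proof.
have sG := generated_subgroup facet_root_maps.
suff gen (c : M -> k) (s : seq M) g : (forall e, e \in s -> facet_root S u e) ->
    acts_by u (pullback g : A -> A) (\sum_(e <- s) c e *: chi e) ->
    generated facet_root_maps g.
  move=> g /unipotent_acts_by[f [gf hf]].
  by apply: (gen (fun e => f@_e) (msupp f)); rewrite -?laurent_chiE.
elim: s g => [|e s IH] g hs hg.
  suff -> : g = 1%g by apply: sG.1.
  apply: acts_by_eq hg _ => m Sm.
  by rewrite big_nil addr0 expr1n mulr1 pullback1 reg_val.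
have he : facet_root S u e by apply: hs; rewrite inE eqxx.
have [h hh] := root_map_exists F (- c e) he.
rewrite -(mulKg h g); apply: (is_subgroupM sG).
  by apply: (is_subgroupV sG); apply: mem_generated; exists e, (- c e).
apply: IH => [b bs|]; first by apply: hs; rewrite inE bs orbT.
have := acts_by_mul F he hh hg.
by rewrite big_cons scaleNr addrAC subrr add0r.
Qed.

(** The ray is arbitrary here. Since [e] pairs to -1 with its own ray generator, no [m + e *+ i]
    with [i] positive equals [m], so the coefficient at [m] stays 1. *)
Lemma root_automorphisms_unipotent : root_automorphisms k S `<=` unipotent.
Proof.
move=> g [v [e [al [[_ ev _] ge]]]] m Sm; have := ge m Sm; rewrite reg_mono => /= gm.
rewrite /weight /image_val gm big_ord_recl bin0 expr0 mulr1 scale1r addr0.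
rewrite mcoeffD mcoeff_chi eqxx raddf_sum big1 ?addr0 // => i _.
rewrite /= mcoeffZ mcoeff_chi; case: eqP => [|_]; last by rewrite mulr0.
move/(congr1 (fun m => pairing m v)); rewrite /= pairingD pairingMn ev mulNrn.
by rewrite -[1 *+ _]/(_%:R) natz /bump /=; lia.
Qed.

Lemma facet_root_maps_root : facet_root_maps `<=` root_automorphisms k S.
Proof.
move=> g [e [al [he ge]]]; exists u, e, al; split.
  exact: (facet_root_demazure F he).
exact: (root_map_is_root_aut F he ge).
Qed.

Lemma generated_root_automorphisms :
  generated (root_automorphisms k S) = unipotent.
Proof.
rewrite eqEsubset; split.
  exact: generated_min unipotent_subgroup root_automorphisms_unipotent.
apply: subset_trans unipotent_generated _; apply: generated_min.
  exact: generated_subgroup.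
apply: subset_trans facet_root_maps_root _; by move=> x; exact: mem_generated.
Qed.

(** The weight of [g] extends to a character of the lattice; dividing [g] by the corresponding torus
    element leaves weight 1. *)
Lemma unipotent_torus g : exists x t, [/\ unipotent x, torus k S t & g = (x * t)%g].
Proof.
have [] := @extend_character k 2 S (weight g).
- have := weight_add g (am0 S) (am0 S); rewrite addr0 => e.
  by apply: (mulfI (weight_nz g (am0 S))); rewrite mulr1 -e.
- by move=> m; apply: weight_nz.
- by move=> m n; apply: weight_add.
move=> s hs sw; have [t ht] := @character_aut k 2 S s hs.1 hs.2.
exists (g * t^-1)%g, t; split; last by rewrite mulgVK.
  move=> m Sm; rewrite weight_mul // weightV //.
  have -> : weight t m = s m.
    by rewrite /weight /image_val ht // mcoeff_scale_reg // eqxx mulr1.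
  by rewrite sw // mulfV // weight_nz.
by apply/torusP; exists s.
Qed.

Lemma aut_semidirect :
  is_semidirect_product (generated (root_automorphisms k S)) (torus k S).
Proof.
rewrite generated_root_automorphisms; split.
- by split; [apply: unipotent_subgroup | apply: torus_subgroup].
- move=> g x hx m Sm; rewrite !weight_mul // weightV // hx // mulr1 mulfV //.
  exact: weight_nz.
- rewrite eqEsubset; split=> [g [hg /torusP[s hs gs]]|_ ->]; last first.
    by split; [apply: unipotent_subgroup.1 | apply: (torus_subgroup k S).1].
  apply: aut_eq => m Sm; have := hg _ Sm.
  rewrite /weight /image_val gs // mcoeff_scale_reg // eqxx mulr1 => ->.
  by rewrite scale1r.
- exact: unipotent_torus.
Qed.

Lemma aut_generated : generated (torus k S `|`
      \bigcup_(H in [set H | is_root_subgroup (S := S) H]) H) = setT.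
Proof.
rewrite eqEsubset; split=> // g _; have [x [t [hx ht ->]]] := unipotent_torus g.
set B := (X in generated X); have sG := generated_subgroup B.
apply: (is_subgroupM sG); last by apply: mem_generated; left.
apply: generated_min sG _ _ (unipotent_generated hx) => h [e [al [he hh]]].
have [H [HR HH]] := root_subgroup k F Sa a1 he.
by apply: mem_generated; right; exists H => //; apply: HH hh.
Qed.

End AutomorphismGroup.

Lemma point_ext (k : fieldType) (A : comAlgType k) (x y : Defs.point A) :
  x =1 y -> x = y.
Proof.
case: x => f [[fD] [fM] [fZ]]; case: y => g [[gD] [gM] [gZ]] /= /funext fg.
by subst g; rewrite (Prop_irrelevance fD gD) (Prop_irrelevance fM gM)
  (Prop_irrelevance fZ gZ).
Qed.

(** * From the singular locus to the chosen facet *)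

Section Main.
Context (k : fieldType) (char0 : [pchar k] =i pred0).
Context (S : affine_monoid 2).
Local Notation A := (monoid_algebra k S).
Local Notation sing := (singular_locus A 2).

(** The distinguished point of the other boundary orbit takes the value 1 on [chi w], which vanishes
    on the singular locus; hence that point is smooth and provides [a]. *)
Lemma proposition3_frame w w' u u' (x1 : Defs.point A) :
  frame S w w' u u' -> (forall x, sing x -> x (reg w) = 0) ->
  sing x1 -> x1 (reg w') != 0 ->
  generated (torus k S `|`
      \bigcup_(H in [set H | is_root_subgroup (S := S) H]) H) = setT
  /\ is_semidirect_product (generated (root_automorphisms k S)) (torus k S).
Proof.
move=> F sing_w sx1 x1w'.
have pres := vanish_sing_aut char0 F sing_w sx1 x1w'.
have [x2 x2E] := boundary_point k F.
have x2w : x2 (reg w) = 1 by rewrite x2E ?(frame_S F) // (frame_w0 F) eqxx.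
have x2s : cotangent_dim x2 2.
  apply: contrapT => /sing_w/eqP; rewrite x2w.
  exact/negP/oner_neq0.
have [a [Sa a1 decomp]] := smooth_boundary char0 F x2E x2s.
split; first exact: (aut_generated char0 F pres Sa a1 decomp).
exact: (aut_semidirect char0 F pres Sa a1 decomp).
Qed.

Lemma sing_boundary w w' u u' x : frame S w w' u u' -> sing x ->
  x (reg w) = 0 \/ x (reg w') = 0.
Proof.
move=> F sx; case: (eqVneq (x (reg w)) 0) => [|xw]; first by left.
case: (eqVneq (x (reg w')) 0) => [|xw']; first by right.
by case: sx; apply: (torus_smooth char0 F).
Qed.

(* Otherwise the singular locus would be contained in the torus fixed point. *)
Lemma sing_orbit w w' u u' : frame S w w' u u' -> has_chain sing 1 ->
  (forall x, sing x -> x (reg w) = 0) -> exists2 x, sing x & x (reg w') != 0.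
Proof.
move=> F [W [irr lt]] sing_w; apply: contrapT => no.
have sing_w' x : sing x -> x (reg w') = 0.
  by move=> sx; apply: contrapT => /eqP h; apply: no; exists x.
have uniq x y : sing x -> sing y -> x = y.
  move=> sx sy; apply: point_ext; apply: lrmorph_eq => m Sm.
  have [xw yw xw' yw'] := And4 (sing_w _ sx) (sing_w _ sy) (sing_w' _ sx) (sing_w' _ sy).
  case: (ltrP 0 (pairing m u')) => m1.
    exact: etrans (point_w_eq0 F xw Sm m1) (esym (point_w_eq0 F yw Sm m1)).
  case: (ltrP 0 (pairing m u)) => m2.
    have F' := frame_sym F.
    exact: etrans (point_w_eq0 F' xw' Sm m2) (esym (point_w_eq0 F' yw' Sm m2)).
  have -> : m = 0.
    have := frame_ge0 F Sm; have := frame_ge0' F Sm => h h'.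
    by apply: (frame_inj F); lia.
  by rewrite reg0; exact: etrans (rmorph1 x) (esym (rmorph1 y)).
(* A strict inclusion of nonempty sets needs two points, but the singular locus has at most one. *)
have [[[x W0x] _] [C _ W0C]] := irr 0%N isT.
have [[_ _] [C' _ W1C]] := irr 1%N isT.
have [sub nsub] := lt 0%N isT.
apply: nsub => y W1y; suff -> : y = x by [].
by apply: uniq; [move: W1y; rewrite W1C => -[] | move: W0x; rewrite W0C => -[]].
Qed.

End Main.

Theorem proposition3 (k : closedFieldType) (char0 : [pchar k] =i pred0)
    (S : affine_monoid 2)
    (ndX : non_degenerate (monoid_algebra k S))
    (sing_irr : zirreducible (singular_locus (monoid_algebra k S) 2))
    (sing_dim : zdim (singular_locus (monoid_algebra k S) 2) 1) :
  generated (torus k S `|`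
      \bigcup_(H in [set H | is_root_subgroup (S := S) H]) H) = setT
  /\ is_semidirect_product (generated (root_automorphisms k S)) (torus k S).
Proof.
have pointed m : m \in S -> - m \in S -> m = 0.
  exact: (non_degenerate_pointed ndX).
have [w [w' [u [u' F]]]] := frame_exists pointed.
have [_ irr] := sing_irr; have [chain _] := sing_dim.
pose Z v : set (Defs.point (monoid_algebra k S)) := zero_locus [set reg v].
have ZC v : zclosed (Z v) by exists [set reg v].
have ZE v x : Z v x -> x (reg v) = 0 by apply.
(* Off both zero loci lies the smooth open orbit, so irreducibility places the singular locus in one
   of them. The two cases differ by exchanging the facets. *)
have [|sub|sub] := irr _ _ (ZC w) (ZC w').
- move=> x sx; case: (sing_boundary char0 F sx) => h; [left|right];
    by move=> _ ->.
- have sw x : singular_locus (monoid_algebra k S) 2 x -> x (reg w) = 0.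
    by move=> /sub/ZE.
  have [x sx xw'] := sing_orbit F chain sw.
  exact: (proposition3_frame char0 F sw sx xw').
- have F' := frame_sym F.
  have sw x : singular_locus (monoid_algebra k S) 2 x -> x (reg w') = 0.
    by move=> /sub/ZE.
  have [x sx xw'] := sing_orbit F' chain sw.
  exact: (proposition3_frame char0 F' sw sx xw').
Qed.
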